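(* Let $0<\alpha<Q$, $\Phi\in\mathcal{Y}$, $\beta\in(0,1)$, let $\varphi:(0,\infty)\to(0,\infty)$ be measurable, and put $\eta(t)=\varphi(t)^\beta$ and $\Psi(t)=\Phi(t^{1/\beta})$. Consider the condition $(\ast)$ there is a constant $C>0$, independent of $t$, such that $t^\alpha\varphi(t)\le C\varphi(t)^\beta$ for all $t>0$. 1. If $\varphi$ satisfies, with a constant $C>0$ independent of $r$, $$\sup_{r<t<\infty}\Phi^{-1}(t^{-Q})\,\operatorname*{ess\,inf}_{t<s<\infty}\frac{\varphi(s)}{\Phi^{-1}(s^{-Q})}\le C\,\varphi(r)\quad\text{for all }r>0,$$ then the condition $$t^\alpha\varphi(t)+\int_t^\infty r^\alpha\varphi(r)\frac{dr}{r}\le C\varphi(t)^\beta\quad\text{for all }t>0,$$ where $C>0$ does not depend on $t$, is sufficient for the boundedness of $I_\alpha$ from $M_{\Phi,\varphi}(X)$ to $WM_{\Psi,\eta}(X)$. 2. If $\varphi\in\mathcal{G}_\Phi$, then condition $(\ast)$ is necessary for the boundedness of $I_\alpha$ from $M_{\Phi,\varphi}(X)$ to $WM_{\Psi,\eta}(X)$. 3. If $\varphi\in\mathcal{G}_\Phi$ satisfies the regularity condition $$\int_t^\infty r^\alpha\varphi(r)\frac{dr}{r}\le C\,t^\alpha\varphi(t)\quad\text{for all }t>0,$$ where $C>0$ does not depend on $t$, then condition $(\ast)$ is necessary and sufficient for the boundedness of $I_\alpha$ from $M_{\Phi,\varphi}(X)$ to $WM_{\Psi,\eta}(X)$.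
   Context: $(X,d,\mu)$ is a space of homogeneous type: $X$ is a topological space with a quasi-distance $d$ (i.e. $d(x,y)\ge 0$, $d(x,y)=0$ iff $x=y$, $d(x,y)=d(y,x)$, $d(x,y)\le K_1(d(x,z)+d(z,y))$) and a positive measure $\mu$; the balls $B(x,r)=\{y\in X:d(x,y)<r\}$, $r>0$, form a basis of neighborhoods of $x$; $\mu$ is defined on a $\sigma$-algebra containing the balls, and $0<\mu(B(x,2r))\le K_2\mu(B(x,r))<\infty$; $K_1,K_2\ge1$ are constants independent of $x,y,z,r$. Standing assumptions: $\mu(X)=\infty$; the compactly supported continuous functions are dense in $L_1(X,\mu)$; $X$ is $Q$-homogeneous for some $Q>0$, i.e. $K_3^{-1}r^Q\le\mu(B(x,r))\le K_3r^Q$ for all $x\in X$, $r>0$, with a constant $K_3\ge1$. A Young function is a convex, left-continuous $\Phi:[0,\infty)\to[0,\infty]$ with $\lim_{r\to+0}\Phi(r)=\Phi(0)=0$ and $\lim_{r\to\infty}\Phi(r)=\infty$. $\mathcal{Y}$ is the set of Young functions with $0<\Phi(r)<\infty$ for $0<r<\infty$. $\Phi^{-1}(s)=\inf\{r\ge0:\Phi(r)>s\}$ ($\inf\emptyset=\infty$). $L_\Phi(X)$ is the set of $f\in L_1^{\rm loc}(X)$ with $\int_X\Phi(\epsilon|f|)d\mu<\infty$ for some $\epsilon>0$, with $\|f\|_{L_\Phi}=\inf\{\lambda>0:\int_X\Phi(|f(x)|/\lambda)d\mu(x)\le1\}$. $WL_\Phi(X)$ is the set of $f\in L_1^{\rm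 loc}(X)$ with $\sup_{r>0}\Phi(r)\,d_{\epsilon f}(r)<\infty$ for some $\epsilon>0$, with $\|f\|_{WL_\Phi}=\inf\{\lambda>0:\sup_{t>0}\Phi(t/\lambda)d_f(t)\le1\}$, where $d_f(t)=\mu(\{x\in X:|f(x)|>t\})$. For a ball $B$: $\|f\|_{L_\Phi(B)}=\|f\chi_B\|_{L_\Phi}$, $\|f\|_{WL_\Phi(B)}=\|f\chi_B\|_{WL_\Phi}$. $L_\Phi^{\rm loc}(X)$ (resp. $WL_\Phi^{\rm loc}(X)$) is the set of $f$ with $f\chi_B\in L_\Phi(X)$ (resp. $WL_\Phi(X)$) for all balls $B$. For a positive measurable $\varphi$ on $(0,\infty)$, $M_{\Phi,\varphi}(X)$ is the set of $f\in L_\Phi^{\rm loc}(X)$ with $\|f\|_{M_{\Phi,\varphi}}=\sup_{x\in X,r>0}\varphi(r)^{-1}\Phi^{-1}(\mu(B(x,r))^{-1})\|f\|_{L_\Phi(B(x,r))}<\infty$, and $WM_{\Phi,\varphi}(X)$ is the set of $f\in WL_\Phi^{\rm loc}(X)$ with $\|f\|_{WM_{\Phi,\varphi}}=\sup_{x\in X,r>0}\varphi(r)^{-1}\Phi^{-1}(\mu(B(x,r))^{-1})\|f\|_{WL_\Phi(B(x,r))}<\infty$. A function $\varphi:(0,\infty)\to(0,\infty)$ is almost increasing (resp. almost decreasing) if there is $C>0$ with $\varphi(r)\le C\varphi(s)$ (resp. $\varphi(r)\ge C\varphi(s)$) for $r\le s$. $\mathcal{G}_\Phi$ is the set of almost decreasing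 $\varphi:(0,\infty)\to(0,\infty)$ such that $t\mapsto\varphi(t)/\Phi^{-1}(t^{-Q})$ is almost increasing. $I_\alpha f(x)=\int_X\frac{f(y)}{d(x,y)^{Q-\alpha}}d\mu(y)$. An operator $T$ is bounded from $A$ to $A'$ if there is $C>0$ with $\|Tf\|_{A'}\le C\|f\|_A$ for all $f\in A$. *)

(* Defs.v *)
From HB Require Import structures.
From mathcomp Require Import all_boot all_order all_algebra.
From mathcomp Require Import all_classical all_reals all_analysis.
From mathcomp Require Import measurable_realfun ess_sup_inf.

Set Implicit Arguments.
Unset Strict Implicit.
Unset Printing Implicit Defensive.

Import Order.TTheory GRing.Theory Num.Theory.
Import numFieldNormedType.Exports.

Local Open Scope classical_set_scope.
Local Open Scope ring_scope.

(* The sigma-algebra and the topology on the carrier are a priori unrelated. *)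
#[short(type="topMeasurableType")]
HB.structure Definition TopMeasurable (disp : measure_display) :=
  {T of Topological T & Measurable disp T}.

Section homogeneous_type.
Context (R : realType) (disp : measure_display) (X : topMeasurableType disp).
Variables (d : X -> X -> R) (mu : {measure set X -> \bar R}).

Definition qball (x : X) (r : R) : set X := [set y | d x y < r].

Definition quasi_distance (K1 : R) : Prop :=
  [/\ forall x y, 0 <= d x y,
      forall x y, d x y = 0 <-> x = y,
      forall x y, d x y = d y x
    & forall x y z, d x y <= K1 * (d x z + d z y)].

Definition qball_nbhs_basis : Prop :=
  forall (x : X) (U : set X),
    nbhs x U <-> exists2 r : R, 0 < r & qball x r `<=` U.

Definition doubling (K2 : R) : Prop :=
  forall x r, 0 < r ->
    (0 < mu (qball x (2 * r)) /\
     mu (qball x (2 * r)) <= K2%:E * mu (qball x r) /\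
     K2%:E * mu (qball x r) < +oo)%E.

Definition homogeneous_type : Prop :=
  [/\ exists2 K1 : R, 1 <= K1 & quasi_distance K1,
      qball_nbhs_basis,
      forall x r, 0 < r -> measurable (qball x r)
    & exists2 K2 : R, 1 <= K2 & doubling K2].

Definition compactly_supported (g : X -> R) : Prop :=
  compact (closure [set x | g x != 0]).

Definition Cc_dense_L1 : Prop :=
  forall f : X -> R, mu.-integrable setT (EFin \o f) ->
  forall e : R, 0 < e ->
  exists g : X -> R,
    [/\ continuous g, compactly_supported g,
        mu.-integrable setT (EFin \o g)
      & (\int[mu]_x `|f x - g x|%:E < e%:E)%E].

Definition Q_homogeneous (Q : R) : Prop :=
  exists2 K3 : R, 1 <= K3 & forall x r, 0 < r ->
    ((K3^-1 * r `^ Q)%:E <= mu (qball x r) <= (K3 * r `^ Q)%:E)%E.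

End homogeneous_type.

(* A function on [0, +oo[ is represented by a function on R whose values at
   negative reals are never used. *)
Section young.
Context (R : realType).
Implicit Type Phi : R -> \bar R.

Definition young_function Phi : Prop :=
  [/\ forall r, 0 <= r -> (0 <= Phi r)%E,
      forall x y t : R, 0 <= x -> 0 <= y -> 0 <= t <= 1 ->
        (Phi (t * x + (1 - t) * y)%R <=
           t%:E * Phi x + (1 - t)%:E * Phi y)%E,
      forall r, 0 < r -> Phi x @[x --> r^'-] --> Phi r,
      Phi 0 = 0%E /\ Phi x @[x --> (0 : R)^'+] --> (0%E : \bar R)
    & Phi x @[x --> +oo%R] --> (+oo%E : \bar R)].

Definition class_Y Phi : Prop :=
  young_function Phi /\ forall r, 0 < r -> (0 < Phi r < +oo)%E.

(* Note that ereal_inf set0 = +oo. *)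
Definition young_inv Phi (s : \bar R) : \bar R :=
  ereal_inf [set r%:E | r in [set r : R | 0 <= r /\ (s < Phi r)%E]].

Definition almost_increasing (g : R -> \bar R) : Prop :=
  exists2 C : R, 0 < C &
    forall r s, 0 < r -> r <= s -> (g r <= C%:E * g s)%E.

Definition almost_decreasing (g : R -> \bar R) : Prop :=
  exists2 C : R, 0 < C &
    forall r s, 0 < r -> r <= s -> (C%:E * g s <= g r)%E.

Definition class_G (Q : R) Phi (phi : R -> R) : Prop :=
  [/\ forall r : R, 0 < r -> 0 < phi r,
      almost_decreasing (EFin \o phi)
    & almost_increasing
        (fun t => (phi t)%:E / young_inv Phi (t `^ (- Q))%:E)%E].

Definition ess_inf_above (t : R) (g : R -> \bar R) : \bar R :=
  ess_inf (mrestr (@lebesgue_measure R) (measurable_itv `]t, +oo[)) g.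

End young.

Section spaces.
Context (R : realType) (disp : measure_display) (X : topMeasurableType disp).
Variables (d : X -> X -> R) (mu : {measure set X -> \bar R}).
Implicit Types (Phi : R -> \bar R) (phi : R -> R).
Implicit Types (f : X -> R) (g : X -> \bar R).

Local Notation B := (qball d).

(* Local integrability is taken over balls, as in LPhi_loc below: closed balls
   need not be compact. *)
Definition L1loc g : Prop :=
  forall x r, 0 < r -> mu.-integrable (B x r) g.

Definition LPhi Phi : set (X -> R) :=
  [set f | L1loc (EFin \o f) /\
     exists2 e : R, 0 < e & (\int[mu]_x Phi (e * `|f x|)%R < +oo)%E].

Definition LPhi_norm Phi f : \bar R :=
  ereal_inf [set l%:E | l in [set l : R |
    0 < l /\ (\int[mu]_x Phi (`|f x| / l)%R <= 1)%E]].

Definition LPhi_loc Phi : set (X -> R) :=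
  [set f | forall x r, 0 < r -> LPhi Phi (f \_ (B x r))].

Definition M_norm Phi phi f : \bar R :=
  ereal_sup [set ((phi p.2)^-1%:E * young_inv Phi (mu (B p.1 p.2))^-1 *
                  LPhi_norm Phi (f \_ (B p.1 p.2)))%E
            | p in [set p : X * R | 0 < p.2]].

Definition M_space Phi phi : set (X -> R) :=
  [set f | LPhi_loc Phi f /\ (M_norm Phi phi f < +oo)%E].

(* The weak spaces consist of extended real-valued functions, because I_alpha f
   may be infinite on a null set. The distribution function is taken with respect to the outer
   measure mu^*, which is mu on measurable sets: d is not assumed to be jointly
   measurable, so the level sets of I_alpha f need not be measurable. *)

Definition distr g (t : R) : \bar R :=
  (mu^*)%mu [set x | (t%:E < `|g x|)%E].

Definition WLPhi Phi : set (X -> \bar R) :=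
  [set g | L1loc g /\
     exists2 e : R, 0 < e &
       (ereal_sup [set Phi r * distr (fun x => e%:E * g x) r
                  | r in [set r : R | (0 < r)%R]] < +oo)%E].

Definition WLPhi_norm Phi g : \bar R :=
  ereal_inf [set l%:E | l in [set l : R | 0 < l /\
    (ereal_sup [set Phi (t / l)%R * distr g t
               | t in [set t : R | (0 < t)%R]] <= 1)%E]].

Definition WLPhi_loc Phi : set (X -> \bar R) :=
  [set g | forall x r, 0 < r -> WLPhi Phi (g \_ (B x r))].

Definition WM_norm Phi phi g : \bar R :=
  ereal_sup [set ((phi p.2)^-1%:E * young_inv Phi (mu (B p.1 p.2))^-1 *
                  WLPhi_norm Phi (g \_ (B p.1 p.2)))%E
            | p in [set p : X * R | 0 < p.2]].

Definition WM_space Phi phi : set (X -> \bar R) :=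
  [set g | WLPhi_loc Phi g /\ (WM_norm Phi phi g < +oo)%E].

(* The value of the integrand at y = x is irrelevant: points are null sets in
   a Q-homogeneous space. *)
Definition riesz_kernel (Q alpha : R) f (x y : X) : \bar R :=
  (f y / d x y `^ (Q - alpha))%:E.

Definition riesz (Q alpha : R) f (x : X) : \bar R :=
  (\int[mu]_y riesz_kernel Q alpha f x y)%E.

(* The integral defining I_alpha f converges absolutely almost everywhere, the
   norm inequality holds, and I_alpha f is an element of the target space; the
   last clause carries the proviso that I_alpha f is measurable, which can fail
   when d is not jointly measurable. *)
Definition riesz_bounded (Q alpha : R) Phi phi Psi (eta : R -> R) : Prop :=
  exists2 C : R, 0 < C & forall f, M_space Phi phi f ->
    [/\ {ae mu, forall x, mu.-integrable setT (riesz_kernel Q alpha f x)},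
        measurable_fun setT (riesz Q alpha f) ->
          WM_space Psi eta (riesz Q alpha f)
      & (WM_norm Psi eta (riesz Q alpha f) <= C%:E * M_norm Phi phi f)%E].

End spaces.

(* Main.v *)
Require Import Defs.
From HB Require Import structures.
From mathcomp Require Import all_boot all_order all_algebra.
From mathcomp Require Import all_classical all_reals all_analysis.
From mathcomp Require Import measurable_realfun ess_sup_inf.
From mathcomp Require Import lra.

Set Implicit Arguments.
Unset Strict Implicit.
Unset Printing Implicit Defensive.

Import Order.TTheory GRing.Theory Num.Theory.
Import numFieldNormedType.Exports.

Local Open Scope classical_set_scope.
Local Open Scope ring_scope.

(** Put [N] for the Morrey norm of [f]. Splitting the kernel over dyadic annuli
    around [x] gives, for every radius [r],
      |I_alpha f (x)| <= C (r^alpha Mf(x) + N int_r^oo t^alpha phi(t) dt/t),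
    where [Mf] is the maximal function: the averages of [|f|] over the large
    balls are at most [C N phi(s)] for all smaller radii [s]. At a radius where
    the two terms balance, the integral condition bounds both of them by
    [N phi(r)^beta] and by [Mf(x) phi(r)^(beta-1)], whence Hedberg's inequality
    |I_alpha f| <= C N^(1-beta) (Mf)^beta. Weak boundedness of the maximal
    operator from [M_(Phi,phi)] to [WM_(Phi,phi)] follows from a Vitali selection
    and, locally, from the Young function growing at least linearly; it turns
    Hedberg's inequality into the theorem. Outer measure is used throughout for
    the level sets, so that measurability of [Mf] never matters.
    For the necessity, test on the indicator function of a ball of radius [r]:
    its Morrey norm is at most [C / phi(r)], and its potential is at least
    [c r^alpha] on the ball. *)

(** * Young functions and their inverses *)

(** In part 1 [phi] may oscillate: it is neither doubling nor almost monotone. This is why averages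
    over a ball of radius [t] are bounded by [phi s] for every [s < t]. Every value of [phi] inside
    a dyadic annulus then controls the same average, and the tail integral dominates the dyadic sum
    without any comparison of values of [phi]. The hypotheses of parts 1 and 3 meet in one property,
    [dominated]. It is applied to the Luxemburg norm of [f] over concentric balls, a quantity that
    grows with the radius while the Morrey norm bounds it by a multiple of phi(s) / Phi^-1(s^-Q) at
    every radius s. The maximal function itself is never formed. [large_average] describes its
    superlevel sets, and Hedberg's inequality is stated off such a set, so a level set of I_alpha f
    is directly contained in one of them. The scales match because Psi(u / l^beta) = Phi(u^(1/beta)
    / l). *)

Section young_inverse.
Context (R : realType).
Implicit Types (Phi : R -> \bar R) (P : R -> R) (r s u : R).

(* Convexity of a Young function is only used through this consequence. *)
Definition starshaped P : Prop :=
  [/\ P 0 = 0, forall r, 0 < r -> 0 < P r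
    & forall th r, 0 <= th <= 1 -> 0 <= r -> P (th * r) <= th * P r].

Definition represents P Phi : Prop := forall r, 0 <= r -> Phi r = (P r)%:E.

Lemma class_Y_starshaped Phi :
  class_Y Phi -> exists2 P, starshaped P & represents P Phi.
Proof.
move=> [[ge0 cvx _ [Phi0 _] _] fin].
have PhiE r : 0 <= r -> Phi r = (fine (Phi r))%:E.
  rewrite le_eqVlt => /predU1P[<-|r0]; first by rewrite Phi0.
  by have /andP[? ?] := fin _ r0; rewrite fineK// ge0_fin_numE// ltW.
exists (fine \o Phi) => //; split => /=.
- by rewrite Phi0.
- by move=> r r0; rewrite -lte_fin -PhiE ?ltW//; case/andP: (fin _ r0).
- move=> th r th01 r0.
  have := cvx r 0 th r0 (lexx _) th01.
  rewrite !mulr0 addr0 Phi0 mule0 adde0 PhiE; last first.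
    by rewrite mulr_ge0//; case/andP: th01.
  by rewrite (PhiE r)// -EFinM lee_fin.
Qed.

Lemma starshaped_le P r u : starshaped P -> 0 <= r -> r <= u -> P r <= P u.
Proof.
move=> [P0 Pgt0 Pth] r0; rewrite le_eqVlt => /predU1P[->//|ru].
have u0 : 0 < u by exact: le_lt_trans ru.
have -> : r = (r / u) * u by rewrite divfK// gt_eqF.
have ru1 : r / u <= 1 by rewrite ler_pdivrMr// mul1r ltW.
apply: le_trans (Pth _ _ _ (ltW u0)) _; first by rewrite ru1 divr_ge0// ltW.
by rewrite ler_piMl// ltW// Pgt0.
Qed.

Lemma starshaped_ge0 P r : starshaped P -> 0 <= r -> 0 <= P r.
Proof.
by move=> sP r0; have := starshaped_le sP (lexx 0) r0; case: sP => ->.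
Qed.

Lemma starshaped_scale P k r : starshaped P -> 1 <= k -> 0 <= r ->
  k * P r <= P (k * r).
Proof.
move=> [P0 Pgt0 Pth] k1 r0; have k0 : 0 < k by exact: lt_le_trans k1.
have := Pth k^-1 (k * r); rewrite mulKf ?gt_eqF// => Pk.
rewrite mulrC -ler_pdivlMr// mulrC Pk ?mulr_ge0 ?(ltW k0)//.
by rewrite invr_ge0 (ltW k0)/= invf_le1.
Qed.

(** Below [a] the first term suffices; above it, P(u) / u is at least P(a) / a because P(r) / r is
    nondecreasing. *)
Lemma starshaped_avg P a u : starshaped P -> 0 < a -> 0 <= u ->
  u <= a + a / P a * P u.
Proof.
move=> sP a0 u0; have Pa0 : 0 < P a by case: sP => _ /(_ _ a0).
have [ua|au] := leP u a.
  by rewrite ler_wpDr// mulr_ge0 ?(starshaped_ge0 sP)// divr_ge0// ltW.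
apply: ler_wpDl; first exact: ltW.
have ua1 : 1 <= u / a by rewrite ler_pdivlMr// mul1r ltW.
have := starshaped_scale sP ua1 (ltW a0).
rewrite divfK ?gt_eqF// => H.
rewrite mulrAC ler_pdivlMr//.
by move: H; rewrite mulrAC ler_pdivrMr// [P u * a]mulrC.
Qed.

Lemma young_inv_le Phi (s : \bar R) u :
  0 <= u -> (s < Phi u)%E -> (young_inv Phi s <= u%:E)%E.
Proof. by move=> u0 su; apply: ereal_inf_lbound; exists u. Qed.

Lemma young_inv_ge Phi (s : \bar R) u :
  {in Num.nneg &, {homo Phi : x y / x <= y >-> (x <= y)%E}} ->
  0 <= u -> (Phi u <= s)%E -> (u%:E <= young_inv Phi s)%E.
Proof.
move=> ndPhi u0 us; apply: le_ereal_inf_tmp => _ [r [r0 sr] <-].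
rewrite lee_fin leNgt; apply/negP => ru.
have := lt_le_trans sr (ndPhi _ _ r0 u0 (ltW ru)).
by rewrite ltNge us.
Qed.

End young_inverse.

Section young_inverse_real.
Context (R : realType) (Phi : R -> \bar R) (P : R -> R).
Hypotheses (sP : starshaped P) (PhiE : represents P Phi).
Implicit Types r s u : R.

(* [Phi^-1] as a real function; [fine] is harmless since [Phi^-1 s] is finite for
   [s > 0], see [rinvE]. *)
Definition rinv s : R := fine (young_inv Phi s%:E).

Let Pgt0 r : 0 < r -> 0 < P r. Proof. by case: sP => _ + _; exact. Qed.

Lemma rinvE s : 0 < s -> young_inv Phi s%:E = (rinv s)%:E.
Proof.
move=> s0; have P10 : 0 < P 1 by exact: Pgt0.
rewrite /rinv fineK// ge0_fin_numE; last first.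
  by apply: le_ereal_inf_tmp => _ [r [r0 _] <-]; rewrite lee_fin.
(* Growth is at least linear, so [P k] is at least [k * P 1 = P 1 + s], which exceeds [s]: the
   infimum is taken over a nonempty set. *)
set k := 1 + s / P 1.
have k1 : 1 <= k by rewrite lerDl divr_ge0// ltW.
have k0 : 0 <= k by exact: le_trans k1.
apply: (@le_lt_trans _ _ k%:E); last by rewrite ltry.
apply: young_inv_le => //.
rewrite PhiE// lte_fin -[k]mulr1.
apply: lt_le_trans (starshaped_scale sP k1 ler01).
by rewrite mulrDl mul1r divfK ?gt_eqF// ltrDr.
Qed.

Lemma rinv_le s u : 0 < s -> 0 <= u -> s < P u -> rinv s <= u.
Proof.
by move=> s0 u0 su; rewrite -lee_fin -rinvE// young_inv_le// PhiE// lte_fin.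
Qed.

Lemma le_rinv s u : 0 < s -> 0 <= u -> u < rinv s -> P u <= s.
Proof.
move=> s0 u0 us; rewrite leNgt; apply/negP => /(rinv_le s0 u0).
by rewrite leNgt us.
Qed.

Lemma rinv_ge s u : 0 < s -> 0 <= u -> P u <= s -> u <= rinv s.
Proof.
move=> s0 u0 us; rewrite -lee_fin -rinvE//; apply: young_inv_ge => //.
  by move=> x y x0 y0 xy; rewrite !PhiE// lee_fin starshaped_le.
by rewrite PhiE.
Qed.

Lemma rinv_gt0 s : 0 < s -> 0 < rinv s.
Proof.
move=> s0; have P10 := Pgt0 ltr01.
set th := Num.min 1 (s / P 1).
have th0 : 0 < th by rewrite lt_min ltr01 divr_gt0.
apply: (lt_le_trans th0); apply: rinv_ge => //; first exact: ltW.
case: sP => _ _ /(_ th 1); rewrite mulr1 => /(_ _ ler01) H.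
apply: le_trans (H _) _; first by rewrite ge_min lexx ltW.
by rewrite -ler_pdivlMr// ge_min lexx orbT.
Qed.

Lemma rinv_lt s u : 0 < s -> rinv s < u -> s < P u.
Proof.
move=> s0; rewrite -lte_fin -rinvE// => /ereal_inf_lt[_ [r [r0 sr] <-]].
rewrite lte_fin => ru; move: sr; rewrite PhiE// lte_fin => /lt_le_trans; apply.
exact: starshaped_le (ltW ru).
Qed.

Lemma le_rinv2 s u : 0 < s -> s <= u -> rinv s <= rinv u.
Proof.
move=> s0 su; have u0 := lt_le_trans s0 su.
rewrite leNgt; apply/negP => /midf_lt[] H1 H2; set m := _ / _ in H1 H2.
have m0 : 0 <= m by rewrite ltW// (lt_trans _ H1)// rinv_gt0.
have := rinv_lt u0 H1; have := le_rinv s0 m0 H2 => ? ?; lra.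
Qed.

(** Superlinear growth of [P] turns into sublinear growth of the inverse. This allows mu(B)^-1 to be
    exchanged for r^-Q at the cost of a factor [K3]. *)
Lemma rinv_scale k s : 1 <= k -> 0 < s -> rinv (k * s) <= k * rinv s.
Proof.
move=> k1 s0; have k0 : 0 < k by exact: lt_le_trans k1.
rewrite -ler_pdivrMl//.
rewrite leNgt; apply/negP => /midf_lt[] H1 H2; set m := _ / _ in H1 H2.
have m0 : 0 < m by rewrite (lt_trans _ H1)// rinv_gt0.
have := rinv_lt s0 H1; move: H2; rewrite -ltr_pdivrMl ?invr_gt0// invrK => H2.
have := le_rinv (mulr_gt0 k0 s0) (mulr_ge0 (ltW k0) (ltW m0)) H2.
move=> H3; have := starshaped_scale sP k1 (ltW m0) => H4.
have := le_trans H4 H3; rewrite ler_pM2l//; lra.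
Qed.

End young_inverse_real.

(** * Vitali selection and the weak type (1,1) inequality *)

(** Only finitely many disjoint sets can each carry mass at least 1/(n+1) of a finite integral. The
    family selected by Zorn's lemma is indexed by centres and radii, and its countability is drawn
    from this. *)
Lemma countable_disjoint_integral (R : realType) (disp : measure_display)
    (T : measurableType disp) (mu : {measure set T -> \bar R}) (I : pointedType)
    (D : set I) (F : I -> set T) (g : T -> \bar R) :
  (forall i, D i -> measurable (F i)) -> trivIset D F ->
  measurable_fun setT g -> (forall x, 0 <= g x)%E ->
  (\int[mu]_x g x < +oo)%E ->
  (forall i, D i -> 0 < \int[mu]_(x in F i) g x)%E -> countable D.
Proof.
move=> mF tF mg g0 gfin Fpos.
pose D' n := [set i | D i /\ (n.+1%:R^-1%:E <= \int[mu]_(x in F i) g x)%E].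
have -> : D = \bigcup_(n in setT) D' n.
  apply/seteqP; split=> [i Di|i [n _ []]//].
  have ifin : (\int[mu]_(x in F i) g x)%E \is a fin_num.
    rewrite ge0_fin_numE ?integral_ge0//.
    by apply: le_lt_trans gfin; apply: ge0_subset_integral => //; exact: mF.
  have := Fpos _ Di; rewrite -(fineK ifin) lte_fin => ip.
  exists (Num.truncn (fine (\int[mu]_(x in F i) g x)%E)^-1) => //; split => //.
  rewrite -(fineK ifin) lee_fin invf_ple ?posrE// ltW//.
  exact: truncnS_gt.
apply: bigcup_countable => // n _; apply: finite_set_countable.
apply: contrapT => /infiniteP/pcard_leP/injfunPex[e f0 finj].
pose G k := F (e k).
have De k : D' n (e k) by apply: f0.
have mG k : measurable (G k) by apply: mF; case: (De k).
have tG : trivIset setT G.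
  move=> i j _ _ Gij; apply: finj; rewrite ?in_setE//.
  by apply: tF => //; [case: (De i)|case: (De j)].
have := @ge0_integral_bigcup _ _ _ mu G g mG.
move=> /(_ (measurable_funTS mg) (fun x _ => g0 x) tG) E.
have : (\int[mu]_(x in \bigcup_k G k) g x < +oo)%E.
  apply: le_lt_trans gfin; apply: ge0_subset_integral => //.
  exact: bigcup_measurable.
apply/negP; rewrite -leNgt leye_eq; apply/eqP; rewrite E.
apply/eqyP => A A0.
set c : R := n.+1%:R^-1; have c0 : 0 < c by rewrite invr_gt0.
set m := (Num.truncn (A / c)).+1.
apply: (@le_trans _ _ (\sum_(0 <= k < m) c%:E)%E).
  rewrite sumEFin lee_fin sumr_const_nat subn0 -mulr_natl -ler_pdivrMr//.
  exact: ltW (truncnS_gt _).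
apply: le_trans (nneseries_lim_ge _ _); last first.
  by move=> *; apply: integral_ge0.
by apply: lee_sum => k _; case: (De k).
Qed.

Section vitali.
Context (R : realType) (disp : measure_display) (X : topMeasurableType disp).
Variables (d : X -> X -> R) (K1 : R).
Hypothesis dq : quasi_distance d K1.

Lemma qdist_xx x : d x x = 0. Proof. by case: dq => _ /(_ x x)[_ ->]. Qed.

Lemma qdistC x y : d x y = d y x. Proof. by case: dq. Qed.

Lemma qdist_triangle x y z : d x y <= K1 * (d x z + d z y).
Proof. by case: dq. Qed.

Lemma qdist_ge0 x y : 0 <= d x y. Proof. by case: dq. Qed.

Let B (p : X * R) := qball d p.1 p.2.

(* Zorn's lemma is applied to the disjoint subfamilies such that every ball of [V]
   meeting the subfamily meets a member of at least half its radius. *)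
Lemma vitali_selection (V : set (X * R)) (M : R) : 0 < K1 ->
  (forall p, V p -> 0 < p.2 <= M) ->
  exists D : set (X * R), [/\ D `<=` V, trivIset D B &
    forall p, V p -> exists2 q, D q & d q.1 p.1 < 3 * K1 * q.2].
Proof.
move=> K10 VM.
pose P (D : set (X * R)) := [/\ D `<=` V, trivIset D B &
  forall p, V p -> (exists2 q, D q & B p `&` B q !=set0) ->
    exists2 q, D q & B p `&` B q !=set0 /\ p.2 <= 2 * q.2].
have [] := @Zorn_bigcup _ P.
  move=> F FP Ftot; split.
  - by move=> p [D FD Dp]; have [+ _ _] := FP _ FD; apply.
  - move=> p q [D FD Dp] [E FE Eq]; have [DE|ED] := Ftot _ _ FD FE.
      by have [_ + _] := FP _ FE; apply => //; exact: DE.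
    by have [_ + _] := FP _ FD; apply => //; exact: ED.
  - move=> p Vp [q [D FD Dq] pq].
    have [_ _ /(_ p Vp)[|q' Dq' ?]] := FP _ FD; first by exists q.
    by exists q' => //; exists D.
move=> D [[DV tD PD] Dmax]; exists D; split => // p Vp.
have [|] := pselect (exists2 q, D q & B p `&` B q !=set0).
  move=> /(PD _ Vp)[q Dq [[z [pz qz]] pq]]; exists q => //.
  (* The common point [z] gives a distance below [K1 * (q.2 + p.2)], and [p.2 <= 2 * q.2]; hence the
     factor 3. *)
  apply: le_lt_trans (qdist_triangle _ _ z) _.
  rewrite -mulrA mulrCA ltr_pM2l//.
  move: pz qz; rewrite /B /qball/= qdistC; lra.
move=> pD; exfalso.
(* The balls that miss the selected family. Adding one whose radius exceeds half the supremum of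
   their radii preserves [P], which contradicts maximality. *)
pose V' := [set p | V p /\ ~ exists2 q, D q & B p `&` B q !=set0].
pose S := sup [set q.2 | q in V'].
have V'p : V' p by [].
have hS : has_sup [set q.2 | q in V'].
  split; first by exists p.2, p.
  by exists M => _ [q [Vq _] <-]; case/andP: (VM _ Vq).
have S0 : 0 < S.
  have /andP[p0 _] := VM _ Vp.
  by apply: lt_le_trans p0 _; apply: ub_le_sup; [case: hS|exists p].
have [_ [q V'q <-] Sq] : exists2 r, [set q.2 | q in V'] r & S / 2 < r.
  have S2 : 0 < S / 2 by rewrite divr_gt0.
  have [r rV' Hr] := sup_adherent S2 hS.
  by exists r => //; apply: le_lt_trans Hr; rewrite -/S; lra.
have [Vq qD] := V'q.
have q2 : 0 < q.2 by case/andP: (VM _ Vq).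
have Bqq : B q q.1 by rewrite /B /qball/= qdist_xx.
apply: (Dmax (q |` D)).
  split; first by move=> ? ?; right.
  move=> qDD; apply: qD; exists q; last by exists q.1.
  by apply: qDD; left.
split.
- by move=> r [->//|/DV].
- move=> i j [->|Di] [->|Dj]//.
  + by move=> ij; exfalso; apply: qD; exists j.
  + by rewrite setIC => ij; exfalso; apply: qD; exists i.
  + exact: tD.
- move=> p' Vp' [r [->|Dr] p'r]; last first.
    have [|q' Dq' ?] := PD _ Vp'; first by exists r.
    by exists q' => //; right.
  have [p'D|p'D] := pselect (exists2 q, D q & B p' `&` B q !=set0).
    have [q' Dq' ?] := PD _ Vp' p'D.
    by exists q' => //; right.
  exists q; first by left.
  split => //; suff : p'.2 <= S by lra.
  by apply: ub_le_sup; [case: hS|exists p'].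
Qed.

End vitali.

Section weak_type.
Context (R : realType) (disp : measure_display) (X : topMeasurableType disp).
Variables (d : X -> X -> R) (mu : {measure set X -> \bar R}) (K1 K3 Q : R).
Hypotheses (dq : quasi_distance d K1) (K11 : 1 <= K1) (K31 : 1 <= K3)
  (Q0 : 0 < Q)
  (mball : forall x r, 0 < r -> measurable (qball d x r))
  (hmu : forall x r, 0 < r ->
    ((K3^-1 * r `^ Q)%:E <= mu (qball d x r) <= (K3 * r `^ Q)%:E)%E).

Let B := qball d.
Let K10 : 0 < K1. Proof. exact: lt_le_trans K11. Qed.
Let K30 : 0 < K3. Proof. exact: lt_le_trans K31. Qed.

Definition vol x r : R := fine (mu (qball d x r)).

Lemma volE x r : 0 < r -> mu (qball d x r) = (vol x r)%:E.
Proof.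
move=> r0; rewrite /vol fineK// ge0_fin_numE//.
by case/andP: (hmu x r0) => _ /le_lt_trans; apply; rewrite ltry.
Qed.

Lemma vol_bounds x r : 0 < r -> K3^-1 * r `^ Q <= vol x r <= K3 * r `^ Q.
Proof. by move=> r0; have := hmu x r0; rewrite volE// !lee_fin. Qed.

Lemma vol_gt0 x r : 0 < r -> 0 < vol x r.
Proof.
move=> r0; case/andP: (vol_bounds x r0) => + _; apply: lt_le_trans.
by rewrite mulr_gt0 ?invr_gt0// powR_gt0.
Qed.

(** The Vitali enlargement by [3 * K1] multiplies r^Q by its [Q]-th power; one [K3] passes from the
    volume to r^Q, the other back. *)
Definition weak_const : R := K3 * K3 * (3 * K1) `^ Q.

Lemma weak_const_gt0 : 0 < weak_const.
Proof. by rewrite /weak_const ?mulr_gt0 ?powR_gt0 ?mulr_gt0. Qed.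

Lemma maximal_weak_type (g : X -> \bar R) (s : R) :
  measurable_fun setT g -> (forall x, 0 <= g x)%E ->
  (\int[mu]_x g x < +oo)%E -> 0 < s ->
  (s%:E * (mu^*)%mu [set x | exists2 r : R, (0 < r)%R &
      s%:E * mu (B x r) < \int[mu]_(y in B x r) g y] <=
    weak_const%:E * \int[mu]_x g x)%E.
Proof.
move=> mg g0 gfin s0; set E := [set x | _].
have subint A : measurable A -> (\int[mu]_(y in A) g y <= \int[mu]_x g x)%E.
  by move=> mA; apply: ge0_subset_integral.
set G := (\int[mu]_x g x)%E in gfin *.
have G0 : (0 <= G)%E by apply: integral_ge0.
have Gfin : G \is a fin_num by rewrite ge0_fin_numE.
pose V := [set p : X * R | 0 < p.2 /\
  (s%:E * mu (B p.1 p.2) < \int[mu]_(y in B p.1 p.2) g y)%E].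
(* Vitali selection needs bounded radii: s K3^-1 r^Q is at most [s] times the volume, hence below
   the total integral of [g]. *)
pose M := (K3 * (fine G / s)) `^ Q^-1.
have VM p : V p -> 0 < p.2 <= M.
  move=> [p0 pV]; rewrite p0/=.
  have : (s%:E * mu (B p.1 p.2) < G)%E.
    by apply: lt_le_trans pV _; apply: subint; exact: mball.
  rewrite volE// -EFinM -(fineK Gfin) lte_fin -ltr_pdivlMl// => /ltW H.
  rewrite /M -[p.2]powRr1 ?(ltW p0)// -(mulfV (lt0r_neq0 Q0)) powRrM.
  rewrite ge0_ler_powR ?nnegrE ?invr_ge0 ?powR_ge0//; first exact: ltW.
    by rewrite mulr_ge0 ?divr_ge0 ?fine_ge0// ltW.
  case/andP: (vol_bounds p.1 p0) => Hv _.
  by rewrite -ler_pdivrMl// (le_trans Hv)// [_ / s]mulrC.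
have [D [DV tD Dcov]] := vitali_selection dq K10 VM.
have mB p : D p -> measurable (qball d p.1 p.2).
  by move=> /DV[p0 _]; exact: mball.
have /pcard_injP[e einj] : countable D.
  apply: (countable_disjoint_integral (mu := mu) (g := g) mB) => //.
  move=> p /DV[p0]; apply: le_lt_trans.
  by rewrite mule_ge0// lee_fin ltW.
(* Countability yields an injection [e] into the naturals, not an enumeration. The balls, dilated by
   [c], are indexed by their codes, with the empty set at each [n] that is not a code. *)
pose F (c : R) (n : nat) := \bigcup_(p in [set p | D p /\ e p = n]) B p.1 (c * p.2).
have FE c p : D p -> F c (e p) = B p.1 (c * p.2).
  move=> Dp; apply/seteqP; split=> [x [q [Dq eqp]]|x ?]; last by exists p.
  by rewrite (einj _ _ _ _ eqp)// inE.
have F0 c n : ~ (exists2 p, D p & e p = n) -> F c n = set0.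
  move=> H; apply/seteqP; split => // x [p [Dp epn]] _.
  by apply: H; exists p.
have mF c n : 0 < c -> measurable (F c n).
  move=> c0; have [[p Dp <-]|H] := pselect (exists2 p, D p & e p = n).
    by rewrite FE//; apply: mball; rewrite mulr_gt0//; case: (DV _ Dp).
  by rewrite F0.
pose F1 := F 1.
have tF : trivIset setT (F1).
  move=> i j _ _ [x [[p [Dp <-] px] [q [Dq <-] qx]]].
  move: px qx; rewrite !mul1r => px qx.
  by congr e; apply: tD => //; exists x.
pose F3 := F (3 * K1).
(* Each point of [E] is the centre of a ball of [V], so the enlarged balls only have to cover
   centres. *)
have EF : E `<=` \bigcup_n F3 n.
  move=> x [r r0 xr].
  have [|p Dp xp] := Dcov (x, r); first by split.
  by exists (e p) => //; rewrite /F3 FE.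
have muE : ((mu^*)%mu E <= \sum_(n <oo) mu (F3 n))%E.
  apply: ereal_inf_lbound; exists (F3) => //; split => // n.
  by apply: mF; rewrite mulr_gt0.
apply: (@le_trans _ _ (s%:E * \sum_(n <oo) mu (F3 n))%E).
  by apply: lee_pmul => //; rewrite ?lee_fin ?(ltW s0) ?mu_ext_ge0.
rewrite -nneseriesZl//.
apply: (@le_trans _ _
    (\sum_(n <oo) weak_const%:E * \int[mu]_(x in F1 n) g x)%E).
  apply: lee_nneseries => [n _ _|n _]; first by rewrite mule_ge0// lee_fin ltW.
  have [[p Dp <-]|H] := pselect (exists2 p, D p & e p = n); last first.
    by rewrite /F3 /F1 !F0// measure0 integral_set0 !mule0.
  have [p0 pV] := DV _ Dp.
  have cp0 : 0 < 3 * K1 * p.2 by rewrite !mulr_gt0.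
  rewrite /F3 /F1 !FE// mul1r.
  apply: (@le_trans _ _ (weak_const%:E * (s%:E * mu (B p.1 p.2)))%E).
    rewrite !volE// -!EFinM lee_fin mulrCA ler_pM2l//.
    case/andP: (vol_bounds p.1 cp0) => _ /le_trans; apply.
    rewrite powRM ?mulr_ge0 ?(ltW K10) ?(ltW p0)// /weak_const -!mulrA ler_pM2l//.
    rewrite mulrCA ler_pM2l; last by rewrite powR_gt0 ?mulr_gt0.
    rewrite -ler_pdivrMl//.
    by case/andP: (vol_bounds p.1 p0).
  apply: lee_pmul => //; rewrite ?lee_fin ?(ltW weak_const_gt0)//.
    by rewrite mule_ge0// lee_fin ltW.
  exact: ltW.
rewrite nneseriesZl; last by move=> n _; apply: integral_ge0.
apply: lee_pmul => //; first by rewrite lee_fin (ltW weak_const_gt0).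
  by apply: nneseries_ge0 => n _ _; apply: integral_ge0.
rewrite -ge0_integral_bigcup//.
- by apply: subint; apply: bigcup_measurable => n _; exact: mF.
- by move=> n; exact: mF.
- exact: measurable_funTS.
Qed.

End weak_type.

(** * Orlicz averages over balls *)

Section orlicz_balls.
Context (R : realType) (disp : measure_display) (X : topMeasurableType disp).
Variables (d : X -> X -> R) (mu : {measure set X -> \bar R}) (K1 K3 Q : R).
Hypotheses (dq : quasi_distance d K1) (K11 : 1 <= K1) (K31 : 1 <= K3)
  (Q0 : 0 < Q)
  (mball : forall x r, 0 < r -> measurable (qball d x r))
  (hmu : forall x r, 0 < r ->
    ((K3^-1 * r `^ Q)%:E <= mu (qball d x r) <= (K3 * r `^ Q)%:E)%E).
Variables (Phi : R -> \bar R) (P : R -> R).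
Hypotheses (sP : starshaped P) (PhiE : represents P Phi).

Local Notation B := (qball d).
Local Notation rinv := (rinv Phi).
Local Notation vol := (vol d mu).

Let Pgt0 r : 0 < r -> 0 < P r. Proof. by case: sP => _ + _; exact. Qed.

Lemma measurable_qdist x : measurable_fun setT (d x).
Proof.
move=> mT; apply: (measurability _ (RGenInftyO.measurableE R)) => //.
move=> _ [_ [r ->] <-]; rewrite setTI.
have [r0|r0] := ltP 0 r.
  have -> : d x @^-1` `]-oo, r[ = B x r; last exact: mball.
  by apply/seteqP; split => y; rewrite /qball/= in_itv.
have -> : d x @^-1` `]-oo, r[ = set0; last exact: measurable0.
apply/seteqP; split => y //=; rewrite in_itv/= => /lt_le_trans/(_ r0).
by rewrite ltNge (qdist_ge0 dq).
Qed.

Lemma ballT x : \bigcup_n B x n.+1%:R = setT.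
Proof.
apply/seteqP; split => // y _; exists (Num.truncn (d x y)) => //.
exact: truncnS_gt.
Qed.

Lemma L1loc_measurable (g : X -> \bar R) : L1loc d mu g -> measurable_fun setT g.
Proof.
move=> Lg; rewrite -(ballT point); apply/measurable_fun_bigcup => n.
  exact: mball.
by have /integrableP[] := Lg point n.+1%:R (ltr0Sn _ n).
Qed.

Lemma M_space_measurable phi f : M_space d mu Phi phi f -> measurable_fun setT f.
Proof.
move=> [Lf _]; rewrite -(ballT point); apply/measurable_fun_bigcup => n.
  exact: mball.
have [Lfn _] := Lf point n.+1%:R (ltr0Sn _ n).
have /measurable_EFinP := L1loc_measurable Lfn.
by move/(measurable_restrictT _ _).2; apply; exact: mball.
Qed.

Lemma measurable_Young (f : X -> R) l : 0 < l -> measurable_fun setT f ->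
  measurable_fun setT (fun x => Phi (`|f x| / l)).
Proof.
move=> l0 mf.
(* [P] is known to be monotone on nonnegative arguments only; truncating at 0 makes it monotone on
   the whole line, hence measurable. *)
have -> : (fun x => Phi (`|f x| / l)) =
    EFin \o ((fun r => P (Num.max r 0)) \o (fun x => `|f x| / l)).
  apply/funext => x /=.
  have fl0 : 0 <= `|f x| / l by rewrite divr_ge0// ltW.
  by rewrite PhiE// max_l.
apply/measurable_EFinP; apply: measurableT_comp.
  apply: nondecreasing_measurable => // x y xy.
  apply: starshaped_le => //; first by rewrite le_max lexx orbT.
  by rewrite ge_max !le_max xy lexx !orbT.
by apply: measurable_funM => //; exact: measurableT_comp.
Qed.

Lemma Phi_ge0 (f : X -> R) l x : 0 < l -> (0 <= Phi (`|f x| / l))%E.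
Proof.
move=> l0; have fl0 : 0 <= `|f x| / l by rewrite divr_ge0// ltW.
by rewrite PhiE// lee_fin starshaped_ge0.
Qed.

(* [u <= a + a / P a * P u] for all [u >= 0], which replaces Jensen's inequality. *)
Lemma integral_Young (f : X -> R) l a A : measurable_fun setT f ->
  measurable A -> 0 < l -> 0 < a ->
  (\int[mu]_(y in A) `|f y|%:E <=
    (l * a)%:E * mu A + (l * (a / P a))%:E * \int[mu]_(y in A) Phi (`|f y| / l)%R)%E.
Proof.
move=> mf mA l0 a0.
have mPhi : measurable_fun A (fun y => Phi (`|f y| / l)).
  by apply: measurable_funTS; exact: measurable_Young.
have c0 : 0 <= l * (a / P a) by rewrite mulr_ge0 ?divr_ge0// ltW// Pgt0.
have la0 : 0 <= l * a by rewrite mulr_ge0// ltW.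
rewrite -ge0_integralZl//; last by move=> y _; exact: Phi_ge0.
rewrite -integral_cst// -ge0_integralD//; last 2 first.
- by move=> y _; rewrite mule_ge0// ?lee_fin// Phi_ge0.
- exact: measurable_funeM.
apply: ge0_le_integral => //.
- by apply/measurable_EFinP; apply: measurable_funTS; exact: measurableT_comp.
- by apply: emeasurable_funD => //; exact: measurable_funeM.
- move=> y Ay; have fl0 : 0 <= `|f y| / l by rewrite divr_ge0// ltW.
  rewrite PhiE// -EFinM -EFinD lee_fin.
  have := starshaped_avg sP a0 fl0.
  by rewrite ler_pdivrMr// => /le_trans; apply; lra.
Qed.

Lemma integral_Young_ball (f : X -> R) x r l : 0 < r -> 0 < l ->
  measurable_fun setT f ->
  (\int[mu]_(y in B x r) Phi (`|f y| / l)%R =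
   \int[mu]_y Phi (`|(f \_ (B x r)) y| / l)%R)%E.
Proof.
move=> r0 l0 mf; rewrite integral_mkcond; apply: eq_integral => y _.
rewrite /patch; case: ifPn => // _.
by rewrite normr0 mul0r PhiE//; case: sP => ->.
Qed.

(** [integral_Young] is used at twice Phi^-1(1/|B|). Doubling the infimum gives P(a) > 1/|B|
    strictly, and each of the two terms is then at most half of the bound. *)
Lemma orlicz_average (f : X -> R) x r l : 0 < r -> 0 < l ->
  measurable_fun setT f ->
  (\int[mu]_y Phi (`|(f \_ (B x r)) y| / l)%R <= 1)%E ->
  (\int[mu]_(y in B x r) `|f y|%:E <=
    (4 * l * rinv (vol x r)^-1 * vol x r)%:E)%E.
Proof.
move=> r0 l0 mf; rewrite -integral_Young_ball// => H.
have v0 : 0 < vol x r := vol_gt0 K31 hmu x r0.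
have q0 : 0 < rinv (vol x r)^-1 by apply: (rinv_gt0 sP PhiE); rewrite invr_gt0.
set q := rinv _ in q0 *.
have a0 : 0 < 2 * q by rewrite mulr_gt0.
have Pa : (vol x r)^-1 < P (2 * q).
  apply: (rinv_lt sP PhiE); first by rewrite invr_gt0.
  by rewrite -/q ltr_pMl// ltr1n.
apply: le_trans (integral_Young mf (mball x r0) l0 a0) _.
rewrite (volE hmu)//.
apply: (@le_trans _ _ ((l * (2 * q))%:E * (vol x r)%:E +
    (l * (2 * q / P (2 * q)))%:E * 1)%E).
  apply: leeD => //; apply: lee_pmul => //.
    by rewrite lee_fin mulr_ge0 ?divr_ge0 ?ltW// Pgt0.
  by apply: integral_ge0 => y _; exact: Phi_ge0.
rewrite mule1 -EFinM -EFinD lee_fin.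
have : 2 * q / P (2 * q) <= 2 * q * vol x r.
  rewrite ler_pM2l// -[leRHS]invrK lef_pV2 ?posrE ?invr_gt0//; first exact: ltW.
  exact: Pgt0.
move=> /(ler_wpM2l (ltW l0)); lra.
Qed.

(** The superlevel set at height [a] of the maximal function whose averages are normalised by r^Q
    instead of the measure of the ball. *)
Definition large_average (f : X -> R) (a : R) (x : X) : Prop :=
  exists2 r : R, 0 < r &
    ((a * r `^ Q)%:E < \int[mu]_(y in B x r) `|f y|%:E)%E.

(** With b = a / (2 K3 l), the constant term of [integral_Young] uses up at most half of a r^Q. The
    rest forces the average of Phi(|f| / l) above P(b), so the weak type (1,1) inequality applies to
    that function. *)
Lemma orlicz_weak_type (f : X -> R) l a : 0 < l -> 0 < a ->
  measurable_fun setT f -> (\int[mu]_y Phi (`|f y| / l)%R <= 1)%E ->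
  ((P (a / (2 * K3 * l)))%:E * (mu^*)%mu [set x | large_average f a x] <=
   (weak_const K1 K3 Q)%:E)%E.
Proof.
move=> l0 a0 mf H.
have K30 : 0 < K3 by exact: lt_le_trans K31.
set b := a / _; have b0 : 0 < b by rewrite divr_gt0// !mulr_gt0.
have Pb0 := Pgt0 b0.
pose g y := Phi (`|f y| / l).
have mg : measurable_fun setT g by exact: measurable_Young.
have g0 y : (0 <= g y)%E by exact: Phi_ge0.
have gfin : (\int[mu]_y g y < +oo)%E by apply: le_lt_trans H _; rewrite ltry.
have W0 := weak_const_gt0 Q K11 K31.
apply: (@le_trans _ _ ((weak_const K1 K3 Q)%:E * \int[mu]_y g y)%E); last first.
  rewrite -[leRHS]mule1; apply: lee_pmul => //; first by rewrite lee_fin ltW.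
  exact: integral_ge0.
apply: le_trans (maximal_weak_type dq K11 K31 Q0 mball hmu mg g0 gfin Pb0).
apply: lee_pmul => //; [by rewrite lee_fin ltW|exact: mu_ext_ge0|].
apply: le_mu_ext => x [r r0 Hr]; exists r => //.
have v0 : 0 < vol x r := vol_gt0 K31 hmu x r0.
have := lt_le_trans Hr (integral_Young mf (mball x r0) l0 b0).
rewrite (volE hmu)// -/(g _).
have [->|] := eqVneq (\int[mu]_(y in B x r) g y)%E +oo%E; first by rewrite ltry.
move=> ny.
have : (\int[mu]_(y in B x r) g y)%E \is a fin_num.
  by rewrite ge0_fin_numE ?ltey// integral_ge0.
move=> /fineK <-; set J := fine _.
rewrite -!EFinM -EFinD !lte_fin => H1.
have aE : a = 2 * K3 * l * b by rewrite mulrC divfK// gt_eqF// !mulr_gt0.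
have lb0 : 0 < l * b by exact: mulr_gt0.
have H2 : 2 * (l * b) * vol x r <= a * r `^ Q.
  have -> : a * r `^ Q = 2 * (l * b) * (K3 * r `^ Q) by rewrite aE; lra.
  rewrite ler_pM2l; last exact: mulr_gt0.
  by have /andP[_] := vol_bounds hmu x r0.
rewrite -ltr_pdivlMl// -(ltr_pM2l lb0).
have -> : l * b * ((P b)^-1 * J) = l * (b / P b) * J by lra.
lra.
Qed.
End orlicz_balls.

(** * Pointwise estimates of the potential *)

Section hedberg.
Context (R : realType).

Lemma dyadic_bracket (x : R) : 1 <= x -> exists k : nat, 2 ^+ k <= x < 2 ^+ k.+1.
Proof.
move=> x1.
have ex : exists n : nat, x < 2 ^+ n.
  exists (Num.truncn x).+1; apply: lt_trans (truncnS_gt x) _.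
  by rewrite -natrX ltr_nat ltn_expl.
case: (ex_minnP ex) => -[|k] xk kmin; first by move: xk; rewrite expr0 ltNge x1.
exists k; rewrite xk andbT leNgt; apply/negP => /kmin.
by rewrite ltnn.
Qed.

Lemma powR_exprn (z a : R) (k : nat) : 0 <= z -> (z ^+ k) `^ a = (z `^ a) ^+ k.
Proof. by move=> z0; rewrite -!powR_mulrn ?powR_ge0// powRAC. Qed.

Lemma nneseries_geometric_le (c w : R) : 0 <= c -> 0 < w < 1 ->
  (\sum_(k <oo) (c * w ^+ k)%:E <= (c / (1 - w))%:E)%E.
Proof.
move=> c0 /andP[w0 w1]; apply: lime_le.
  apply: is_cvg_nneseries => k _ _.
  by rewrite lee_fin mulr_ge0// exprn_ge0// ltW.
apply: nearW => n; rewrite sumEFin lee_fin.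
have := geometric_le_lim n c0 w0; rewrite ger0_norm ?(ltW w0)// => /(_ w1).
by rewrite /series.
Qed.

Context (disp : measure_display) (X : topMeasurableType disp).
Variables (d : X -> X -> R) (mu : {measure set X -> \bar R}) (K1 Q alpha : R).
Hypotheses (dq : quasi_distance d K1)
  (mball : forall x r, 0 < r -> measurable (qball d x r))
  (aQ : 0 < alpha < Q).

Local Notation B := (qball d).

Lemma measurable_riesz_kernel (f : X -> R) x : measurable_fun setT f ->
  measurable_fun setT (riesz_kernel d Q alpha f x).
Proof.
move=> mf; apply/measurable_EFinP; apply: measurable_funM => //.
have -> : (fun y => (d x y `^ (Q - alpha))^-1) =
    (fun t => t `^ (- (Q - alpha))) \o d x.
  by apply/funext => y /=; rewrite powRN.
apply: measurableT_comp; first exact: measurable_powR.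
exact: measurable_qdist dq mball x.
Qed.

(** Each annulus is replaced by a ball containing it, because integrals of |f| are controlled over
    balls only; the kernel is bounded there by its largest value on the annulus. *)
Lemma integral_kernel_le (f : X -> R) x A (c : nat -> R) (r : nat -> R) :
  measurable_fun setT f -> measurable A ->
  (forall k, 0 <= c k) -> (forall k, 0 < r k) ->
  (forall y, A y -> 0 < d x y ->
     exists k, B x (r k) y /\ (d x y `^ (Q - alpha))^-1 <= c k) ->
  (\int[mu]_(y in A) `|riesz_kernel d Q alpha f x y| <=
   \sum_(k <oo) (c k)%:E * \int[mu]_(y in B x (r k)) `|f y|%:E)%E.
Proof.
move=> mf mA c0 r0 cov.
have mB k : measurable (B x (r k)) by exact: mball.
have mabs : measurable_fun setT (fun y => `|f y|%:E).
  by apply/measurable_EFinP; exact: measurableT_comp.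
pose h k := (fun y => (c k)%:E * ((fun y => `|f y|%:E) \_ (B x (r k))) y)%E.
have mh k : measurable_fun setT (h k).
  apply: measurable_funeM; apply/(measurable_restrictT _ _).1 => //.
  exact: measurable_funTS.
have h0 k y : (0 <= h k y)%E.
  by rewrite mule_ge0 ?lee_fin//; apply: erestrict_ge0 => z _; rewrite lee_fin.
have -> : (\sum_(k <oo) (c k)%:E * \int[mu]_(y in B x (r k)) `|f y|%:E =
           \int[mu]_y \sum_(k <oo) h k y)%E.
  rewrite integral_nneseries//; apply: eq_eseriesr => k _.
  rewrite ge0_integralZl//.
  - by rewrite -integral_mkcond.
  - apply/(measurable_restrictT _ _).1 => //; exact: measurable_funTS.
  - by move=> y _; apply: erestrict_ge0 => z _; rewrite lee_fin.
  - by rewrite lee_fin.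
have mS : measurable_fun setT (fun y => \sum_(k <oo) h k y)%E.
  by apply: ge0_emeasurable_sum => //.
have S0 y : (0 <= \sum_(k <oo) h k y)%E by apply: nneseries_ge0.
apply: (@le_trans _ _ (\int[mu]_(y in A) \sum_(k <oo) h k y)%E); last first.
  exact: ge0_subset_integral.
apply: ge0_le_integral => //.
- apply: measurableT_comp => //; apply: measurable_funTS.
  exact: measurable_riesz_kernel.
- exact: measurable_funTS.
(* On the diagonal the power of the distance is 0, and division by 0 makes the kernel 0. This is why
   the covering hypothesis asks for positive distance. *)
move=> y Ay; have [d0|d0] := eqVneq (d x y `^ (Q - alpha)) 0.
  by rewrite /riesz_kernel d0 invr0 mulr0 abse0.
have dxy : 0 < d x y.
  rewrite lt_neqAle (qdist_ge0 dq) andbT eq_sym.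
  apply: contraNneq d0 => ->; rewrite powR0// subr_eq0.
  by case/andP: aQ => _ /gt_eqF ->.
have [k [Bk ck]] := cov _ Ay dxy.
apply: le_trans (nneseries_lim_ge k.+1 _); last by [].
rewrite big_nat_recr//= -[leLHS]add0e; apply: leeD.
  by apply: sume_ge0.
rewrite /h patchE mem_set// -EFinM lee_fin normrM mulrC ler_wpM2r//.
by rewrite ger0_norm// invr_ge0 powR_ge0.
Qed.

(** On the annulus s_k / 2 < d <= s_k the kernel costs 2^(Q-alpha). The outer endpoint is attained
    and balls are open, so the radius is doubled, which costs 2^Q. The remaining factor sums the
    geometric series of ratio 2^-alpha. *)
Lemma riesz_near (f : X -> R) x (a r : R) : measurable_fun setT f -> 0 < a -> 0 < r ->
  (forall t, 0 < t ->
    (\int[mu]_(y in B x t) `|f y|%:E <= (a * t `^ Q)%:E)%E) ->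
  (\int[mu]_(y in B x r) `|riesz_kernel d Q alpha f x y| <=
   (2 `^ (Q - alpha) * 2 `^ Q / (1 - 2^-1 `^ alpha) * (r `^ alpha * a))%:E)%E.
Proof.
move=> mf a0 r0 Ha; have [al0 alQ] := andP aQ.
have h0 : 0 < 2^-1 :> R by rewrite invr_gt0.
pose s k : R := r * 2^-1 ^+ k.
have s0 k : 0 < s k by rewrite mulr_gt0// exprn_gt0.
pose c k := (s k / 2) `^ (- (Q - alpha)).
apply: le_trans (integral_kernel_le (c := c) (r := fun k => 2 * s k)
  mf (mball x r0) _ _ _) _ => [k|k|y|].
- exact: powR_ge0.
- by rewrite mulr_gt0.
- rewrite /qball/= => dr d0.
  have /dyadic_bracket[k /andP[k1 k2]] : 1 <= r / d x y.
    by rewrite ler_pdivlMr// mul1r ltW.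
  have p0 : 0 < 2 ^+ k :> R by rewrite exprn_gt0.
  have dk : d x y <= s k.
    by rewrite /s exprVn ler_pdivlMr// mulrC -ler_pdivlMr.
  have kd : s k / 2 <= d x y.
    rewrite ltW// /s exprVn -mulrA -invfM -exprSr ltr_pdivrMr ?exprn_gt0//.
    by rewrite mulrC -ltr_pdivrMr.
  exists k; split; first by rewrite (le_lt_trans dk)// ltr_pMl// ltr1n.
  rewrite /c powRN lef_pV2 ?posrE ?powR_gt0 ?divr_gt0//.
  rewrite ge0_ler_powR ?nnegrE ?subr_ge0 ?(ltW alQ) ?divr_ge0 ?(ltW (s0 k))//.
  exact: ltW.
set w := 2^-1 `^ alpha.
have w01 : 0 < w < 1.
  rewrite powR_gt0//=.
  have : 2^-1 `^ alpha < 1 `^ alpha.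
    rewrite gt0_ltr_powR ?nnegrE ?invr_ge0//.
    by rewrite invf_lt1// ltr1n.
  by rewrite powR1.
set C := 2 `^ (Q - alpha) * 2 `^ Q * (r `^ alpha * a).
apply: (@le_trans _ _ (\sum_(k <oo) (C * w ^+ k)%:E)%E); last first.
  apply: le_trans (nneseries_geometric_le _ w01) _.
    by rewrite !mulr_ge0 ?powR_ge0// ltW.
  by rewrite lee_fin /C le_eqVlt; apply/orP; left; apply/eqP; lra.
apply: lee_nneseries => [k _ _|k _].
  rewrite mule_ge0 ?lee_fin ?powR_ge0//; apply: integral_ge0 => y _.
  by rewrite lee_fin.
have s20 : 0 < 2 * s k by rewrite mulr_gt0.
apply: (@le_trans _ _ ((c k)%:E * (a * (2 * s k) `^ Q)%:E)%E).
  by apply: lee_pmul => //; [rewrite lee_fin powR_ge0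
    |apply: integral_ge0 => y _; rewrite lee_fin|exact: Ha].
rewrite -EFinM lee_fin.
have -> : c k = 2 `^ (Q - alpha) * s k `^ (- (Q - alpha)).
  rewrite /c powRM ?invr_ge0 ?(ltW (s0 k))// mulrC; congr (_ * _).
  by rewrite -powR_inv1// -powRrM mulN1r opprK.
have -> : (2 * s k) `^ Q = 2 `^ Q * s k `^ Q by rewrite powRM// ltW.
have sa : s k `^ (- (Q - alpha)) * s k `^ Q = r `^ alpha * w ^+ k.
  rewrite -powRD; last by rewrite (gt_eqF (s0 k)) implybT.
  rewrite opprB subrK /s powRM ?exprn_ge0 ?(ltW r0) ?(ltW h0)//.
  by rewrite powR_exprn// ltW.
rewrite /C; set u := s k `^ Q in sa *; set v := s k `^ _ in sa *.
rewrite -[leRHS]mulrA -[r `^ alpha * a * _]mulrA [a * _]mulrC [leRHS]mulrA.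
rewrite le_eqVlt; apply/orP; left; apply/eqP.
transitivity (2 `^ (Q - alpha) * 2 `^ Q * a * (v * u)); first by lra.
rewrite sa; lra.
Qed.

(** The integral of |f| over the ball of radius s_(k+1) bounds phi(t) from below for each t in ]s_k,
    s_(k+1)[, so the k-th term is at most a multiple of the tail integral over that interval. The
    constant collects 2^Q from the ratio of the radii and 2 from interval length over right
    endpoint. *)
Lemma riesz_far (f : X -> R) x (N r : R) (phi : R -> R) :
  measurable_fun setT f -> 0 < N -> 0 < r -> (forall t, 0 < t -> 0 < phi t) ->
  measurable_fun (`]0, +oo[ : set R) phi ->
  (forall s t, 0 < s < t ->
    (\int[mu]_(y in B x t) `|f y|%:E <= (N * phi s * t `^ Q)%:E)%E) ->
  (\int[mu]_(y in ~` B x r) `|riesz_kernel d Q alpha f x y| <=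
   (2 * 2 `^ Q * N)%:E *
     \int[lebesgue_measure]_(t in `]r, +oo[) (t `^ alpha * phi t / t)%:E)%E.
Proof.
move=> mf N0 r0 phi0 mphi HN; have [al0 alQ] := andP aQ.
pose s k : R := r * 2 ^+ k.
have s0 k : 0 < s k by rewrite mulr_gt0// exprn_gt0.
have sS k : s k.+1 = 2 * s k by rewrite /s exprS; lra.
have sle k : s k <= s k.+1 by rewrite sS; have := s0 k; lra.
have sr k : r <= s k by rewrite ler_peMr ?(ltW r0)// exprn_ege1// ler1n.
pose c k := s k `^ (- (Q - alpha)).
apply: le_trans (integral_kernel_le (c := c) (r := fun k => s k.+1)
  mf (measurableC (mball x r0)) _ _ _) _ => [k|k|y|].
- exact: powR_ge0.
- exact: s0.
- rewrite /qball/= => /negP; rewrite -leNgt => dr d0.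
  have /dyadic_bracket[k /andP[k1 k2]] : 1 <= d x y / r.
    by rewrite ler_pdivlMr// mul1r.
  exists k; split; first by rewrite /s mulrC -ltr_pdivrMr.
  have kd : s k <= d x y by rewrite /s mulrC -ler_pdivlMr.
  rewrite /c powRN lef_pV2 ?posrE ?powR_gt0//.
  by rewrite ge0_ler_powR ?nnegrE ?subr_ge0 ?(ltW alQ) ?(ltW d0) ?(ltW (s0 k)).
(* Open intervals are pairwise disjoint and fit the strict inequality in the average bound; only a
   lower bound of the tail integral is wanted, so the endpoints may be dropped. *)
pose I k := (`]s k, s k.+1[%classic : set R).
pose F t : \bar R := (t `^ alpha * phi t / t)%:E.
have F0 t : 0 < t -> (0 <= F t)%E.
  by move=> t0; rewrite lee_fin mulr_ge0 ?mulr_ge0 ?powR_ge0 ?invr_ge0 ?ltW ?phi0.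
have mF : measurable_fun (`]0, +oo[ : set R) F.
  apply/measurable_EFinP; apply: measurable_funM.
    by apply: measurable_funM => //; apply: measurable_funTS; exact: measurable_powR.
  apply: open_continuous_measurable_fun; first exact: interval_open.
  by move=> t; rewrite inE/= in_itv/= andbT => t0; apply: inv_continuous; rewrite gt_eqF.
have Ipos k t : I k t -> 0 < t.
  by rewrite /I/= in_itv/= => /andP[st _]; exact: lt_trans (s0 k) st.
have mI k : measurable (I k) by exact: measurable_itv.
have mFI k : measurable_fun (I k) F.
  by apply: measurable_funS mF => // t /Ipos; rewrite /= in_itv/= andbT.
have tI : trivIset setT I.
  apply: ltn_trivIset => n m mn; apply/seteqP; split => // t [].
  rewrite /I/= !in_itv/= => /andP[h1 h2] /andP[h3 h4].
  have : s m.+1 <= s n.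
    by rewrite /s ler_pM2l// ler_eXn2l ?ltr1n.
  lra.
apply: (@le_trans _ _ ((2 * 2 `^ Q * N)%:E *
    \int[lebesgue_measure]_(t in \bigcup_k I k) F t)%E); last first.
  apply: lee_pmul => //.
  - by rewrite lee_fin !mulr_ge0 ?powR_ge0// ltW.
  - by apply: integral_ge0 => t [k _ /Ipos]; exact: F0.
  - apply: ge0_subset_integral => //.
    + by apply: bigcup_measurable => k _; exact: mI.
    + apply: measurable_funS mF => // t /=.
      by rewrite !in_itv/= !andbT; exact: (lt_trans r0).
    + by move=> t /=; rewrite in_itv/= andbT => /(lt_trans r0); exact: F0.
    + move=> t [k _]; rewrite /I/= !in_itv/= andbT => /andP[+ _].
      exact: (le_lt_trans (sr k)).
rewrite ge0_integral_bigcup//; last 2 first.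
- by apply/measurable_fun_bigcup.
- by move=> t [k _ /Ipos]; exact: F0.
rewrite -nneseriesZl; last first.
  by move=> k _; apply: integral_ge0 => t /Ipos; exact: F0.
apply: lee_nneseries => [k _ _|k _].
  rewrite mule_ge0 ?lee_fin ?powR_ge0//; apply: integral_ge0 => y _.
  by rewrite lee_fin.
set J := (\int[mu]_(y in B x (s k.+1)) `|f y|%:E)%E.
have J0 : (0 <= J)%E by apply: integral_ge0 => y _; rewrite lee_fin.
have Jfin : J \is a fin_num.
  rewrite ge0_fin_numE//; apply: le_lt_trans (HN (s k.+1 / 2) (s k.+1) _) _.
    by rewrite divr_gt0//=; have := s0 k.+1; lra.
  by rewrite ltry.
set j := fine J; have j0 : 0 <= j by exact: fine_ge0.
have JE : J = j%:E by rewrite /j fineK.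
(* A lower bound of the integrand on [I k]: each of its three factors is replaced by a smaller
   value, the middle one through the average bound [HN]. *)
pose m := s k `^ alpha * (j / (N * s k.+1 `^ Q)) / s k.+1.
have m0 : 0 <= m by rewrite !mulr_ge0 ?invr_ge0 ?mulr_ge0 ?powR_ge0// ltW.
have Fm t : I k t -> (m%:E <= F t)%E.
  move=> It; have t0 := Ipos _ _ It; move: It.
  rewrite /I/= in_itv/= => /andP[st ts]; rewrite lee_fin /m.
  apply: ler_pM; rewrite ?invr_ge0 ?(ltW (s0 _))//.
  - by rewrite !mulr_ge0 ?invr_ge0 ?mulr_ge0 ?powR_ge0// ltW.
  - apply: ler_pM; rewrite ?powR_ge0//.
    + by rewrite !mulr_ge0 ?invr_ge0 ?mulr_ge0 ?powR_ge0// ltW.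
    + by rewrite ge0_ler_powR ?nnegrE ?(ltW al0) ?(ltW t0) ?(ltW st) ?(ltW (s0 _)).
    + have := HN t (s k.+1); rewrite t0 ts -/J JE lee_fin => /(_ isT).
      by rewrite ler_pdivrMr ?mulr_gt0 ?powR_gt0// mulrCA mulrA.
  - by rewrite lef_pV2 ?posrE// ltW.
apply: (@le_trans _ _ ((2 * 2 `^ Q * N)%:E *
    \int[lebesgue_measure]_(t in I k) (cst m%:E) t)%E); last first.
  apply: lee_pmul => //.
  - by rewrite lee_fin !mulr_ge0 ?powR_ge0// ltW.
  - by apply: integral_ge0.
  - by apply: ge0_le_integral => //; [exact: mI|exact: mFI].
have -> : (\int[lebesgue_measure]_(t in I k) (cst m%:E) t =
    (m * (s k.+1 - s k))%:E)%E.
  rewrite integral_cst; last exact: mI.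
  have /(congr1 (fun z => m%:E * z)%E) : lebesgue_measure (I k) = (s k.+1 - s k)%:E.
    rewrite /I lebesgue_measure_itv/= lte_fin ifT// sS.
    by have := s0 k; lra.
  exact.
rewrite -/J JE -!EFinM lee_fin sS /m.
have sQ0 : 0 < s k `^ Q by rewrite powR_gt0.
have Q20 : 0 < 2 `^ Q :> R by rewrite powR_gt0.
rewrite sS powRM ?(ltW (s0 _))//.
have -> : c k = s k `^ alpha / s k `^ Q.
  by rewrite /c opprB powRB// (gt_eqF (s0 k)) implybT.
rewrite le_eqVlt; apply/orP; left; apply/eqP.
move: (s0 k) sQ0 Q20 N0; move: (s k) (s k `^ Q) (2 `^ Q) (s k `^ alpha).
move=> a b e g a0 b0 e0 N0.
have -> : 2 * a - a = a by lra.
rewrite !invfM.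
transitivity (g * b^-1 * j * (2 / 2) * (e / e) * (N / N) * (a / a)); last by lra.
rewrite !divff ?gt_eqF//; lra.
Qed.

End hedberg.

(** * Hedberg's inequality: balancing the near and far estimates *)

Section hedberg_selection.
Context (R : realType).
Implicit Types a N r c p : R.

(** As functions of [p] the first expression increases and the second decreases. They cross at p = a
    / N, where both equal the right-hand side. *)
Lemma min_interpolation N a p beta : 0 < N -> 0 < a -> 0 < p -> 0 < beta < 1 ->
  Num.min (N * p `^ beta) (a * (p `^ beta / p)) <= N `^ (1 - beta) * a `^ beta.
Proof.
move=> N0 a0 p0 /andP[b0 b1].
have split1 z : 0 < z -> z = z `^ (1 - beta) * z `^ beta.
  move=> z0; rewrite -powRD ?subrK ?powRr1 ?(ltW z0)//.
  by rewrite (gt_eqF z0) implybT.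
have [pa|ap] := leP (N * p) a.
  rewrite ge_min; apply/orP; left.
  rewrite {1}(split1 _ N0) -mulrA ler_wpM2l ?powR_ge0// -powRM ?(ltW N0) ?(ltW p0)//.
  by rewrite ge0_ler_powR ?nnegrE ?mulr_ge0 ?(ltW N0) ?(ltW p0) ?(ltW b0) ?(ltW a0).
rewrite ge_min; apply/orP; right.
have -> : p `^ beta / p = (p `^ (1 - beta))^-1.
  rewrite {2}(split1 _ p0) invfM mulrCA divff ?mulr1//.
  by rewrite gt_eqF// powR_gt0.
rewrite mulrC mulrC ler_pdivrMr ?powR_gt0//.
rewrite {1}(split1 _ a0) -[leRHS]mulrA [a `^ beta * _]mulrC [leRHS]mulrA.
rewrite ler_wpM2r ?powR_ge0// -powRM ?(ltW N0) ?(ltW p0)//.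
by rewrite ge0_ler_powR ?nnegrE ?mulr_ge0 ?subr_ge0 ?(ltW N0) ?(ltW p0) ?(ltW b1)
  ?(ltW a0) ?(ltW ap).
Qed.

(* The radius is chosen so that the two terms are balanced up to a factor 2:
   [r] below the supremum of the radii where the near part is dominated by the
   tail, [2 * r] above it. *)
Lemma hedberg_balance (F : \bar R) (T : R -> \bar R) (phi : R -> R)
    c a N alpha beta Cs :
  0 < c -> 0 < a -> 0 < N -> 0 < alpha -> 0 < beta < 1 -> 0 < Cs ->
  (forall t, 0 < t -> 0 < phi t) -> (forall t, 0 < t -> (0 <= T t)%E) ->
  (forall t, 0 < t ->
    ((t `^ alpha * phi t)%:E + T t <= (Cs * phi t `^ beta)%:E)%E) ->
  (forall r, 0 < r -> (F <= (c * (r `^ alpha * a))%:E + (c * N)%:E * T r)%E) ->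
  (F <= (2 * c * 2 `^ alpha * Cs * (N `^ (1 - beta) * a `^ beta))%:E)%E.
Proof.
move=> c0 a0 N0 al0 b01 Cs0 phi0 T0 HT HF.
set M := N `^ (1 - beta) * a `^ beta.
have M0 : 0 < M by rewrite mulr_gt0// powR_gt0.
have alpha2 : 1 <= 2 `^ alpha :> R.
  have : 1 `^ alpha <= 2 `^ alpha :> R.
    by rewrite ge0_ler_powR ?nnegrE// ?(ltW al0)// ler1n.
  by rewrite powR1.
pose A := [set r : R | 0 < r /\ ((r `^ alpha * a)%:E <= N%:E * T r)%E].
(* On [A] the near part is bounded through the tail, giving N phi^beta. The term t^alpha phi(t) of
   the integral condition always bounds it by a phi^(beta-1). The smaller of the two is at most
   [M]. *)
have AM r : A r -> r `^ alpha * a <= Cs * M.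
  move=> [r0 Ar]; have p0 := phi0 _ r0.
  have h1 : r `^ alpha * a <= Cs * (N * phi r `^ beta).
    rewrite -lee_fin; apply: le_trans Ar _.
    rewrite mulrCA EFinM; apply: lee_pmul => //; rewrite ?T0// ?lee_fin ?(ltW N0)//.
    apply: le_trans (HT _ r0); rewrite leeDr// lee_fin.
    by rewrite mulr_ge0 ?powR_ge0// ltW.
  have h2 : r `^ alpha * a <= Cs * (a * (phi r `^ beta / phi r)).
    rewrite mulrC mulrCA ler_pM2l// mulrA ler_pdivlMr// -lee_fin.
    by apply: le_trans (HT _ r0); rewrite leeDl// T0.
  apply: le_trans (ler_wpM2l (ltW Cs0) (min_interpolation N0 a0 p0 b01)).
  by rewrite minEle; case: ifP.
have nA r : 0 < r -> ~ A r -> (F <= (2 * c * (r `^ alpha * a))%:E)%E.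
  move=> r0 Ar; apply: le_trans (HF _ r0) _.
  have : (N%:E * T r <= (r `^ alpha * a)%:E)%E.
    by rewrite leNgt; apply/negP => /ltW H; apply: Ar.
  move=> H; apply: (@le_trans _ _
      ((c * (r `^ alpha * a))%:E + c%:E * (r `^ alpha * a)%:E)%E).
    apply: leeD => //; rewrite EFinM -muleA; apply: lee_pmul => //.
      by rewrite lee_fin ltW.
    by rewrite mule_ge0 ?T0// lee_fin ltW.
  by rewrite -EFinM -EFinD lee_fin le_eqVlt; apply/orP; left; apply/eqP; lra.
have [A0|/set0P[r1 Ar1]] := eqVneq A set0.
  (* With [A] empty every radius is admissible; this one solves r^alpha a = Cs M. *)
  pose r := (Cs * M / a) `^ alpha^-1.
  have CMa0 : 0 < Cs * M / a by apply: divr_gt0 => //; exact: mulr_gt0.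
  have r0 : 0 < r by rewrite powR_gt0.
  apply: le_trans (nA _ r0 _) _; first by rewrite A0.
  rewrite lee_fin /r -powRrM mulVf ?gt_eqF// powRr1 ?(ltW CMa0)//.
  rewrite divfK ?gt_eqF// -!mulrA ler_pM2l// ler_pM2l// ler_peMl//.
  by rewrite ltW// mulr_gt0.
have hA : has_sup A.
  split; first by exists r1.
  exists ((Cs * M / a) `^ alpha^-1) => r Ar; have [r0 _] := Ar.
  rewrite -[r](powRr1 (ltW r0)) -(mulfV (lt0r_neq0 al0)) powRrM.
  rewrite ge0_ler_powR ?nnegrE ?invr_ge0 ?powR_ge0 ?(ltW al0)//.
    exact: ltW (divr_gt0 (mulr_gt0 Cs0 M0) a0).
  by rewrite ler_pdivlMr// AM.
have S0 : 0 < sup A.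
  have [r10 _] := Ar1; apply: lt_le_trans r10 _.
  by apply: ub_le_sup => //; case: hA.
have [r Ar Sr] : exists2 r, A r & sup A / 2 < r.
  have S2 : 0 < sup A / 2 by rewrite divr_gt0.
  have [r Ar Hr] := sup_adherent S2 hA.
  by exists r => //; apply: le_lt_trans Hr; lra.
have [r0 _] := Ar.
apply: le_trans (nA (2 * r) _ _) _; first by rewrite mulr_gt0.
  move=> A2r; have : 2 * r <= sup A by apply: ub_le_sup => //; case: hA.
  lra.
rewrite lee_fin powRM ?(ltW r0)// -!mulrA ler_pM2l// ler_pM2l// ler_pM2l ?powR_gt0//.
exact: AM.
Qed.

Context (disp : measure_display) (X : topMeasurableType disp).
Variables (d : X -> X -> R) (mu : {measure set X -> \bar R}) (K1 Q alpha : R).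
Hypotheses (dq : quasi_distance d K1)
  (mball : forall x r, 0 < r -> measurable (qball d x r))
  (aQ : 0 < alpha < Q).

Local Notation B := (qball d).

Definition near_const : R := 2 `^ (Q - alpha) * 2 `^ Q / (1 - 2^-1 `^ alpha).

Definition hedberg_const (Cs : R) : R :=
  2 * (near_const + 2 * 2 `^ Q) * 2 `^ alpha * Cs.

Lemma near_const_gt0 : 0 < near_const.
Proof.
have al0 : 0 < alpha by case/andP: aQ.
rewrite divr_gt0 ?mulr_gt0 ?powR_gt0// subr_gt0.
have : 2^-1 `^ alpha < 1 `^ alpha.
  by rewrite gt0_ltr_powR ?nnegrE ?invr_ge0// invf_lt1// ltr1n.
by rewrite powR1.
Qed.

Lemma hedberg_const_gt0 Cs : 0 < Cs -> 0 < hedberg_const Cs.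
Proof.
by move=> Cs0; rewrite !mulr_gt0 ?powR_gt0// addr_gt0 ?near_const_gt0//.
Qed.

Lemma riesz_hedberg (f : X -> R) x (phi : R -> R) (a N beta Cs : R) :
  measurable_fun setT f -> 0 < a -> 0 < N -> 0 < beta < 1 -> 0 < Cs ->
  (forall t, 0 < t -> 0 < phi t) -> measurable_fun (`]0, +oo[ : set R) phi ->
  (forall t, 0 < t ->
    ((t `^ alpha * phi t)%:E +
     \int[lebesgue_measure]_(r in `]t, +oo[) (r `^ alpha * phi r / r)%:E <=
     (Cs * phi t `^ beta)%:E)%E) ->
  (forall t, 0 < t ->
    (\int[mu]_(y in B x t) `|f y|%:E <= (a * t `^ Q)%:E)%E) ->
  (forall s t, 0 < s < t ->
    (\int[mu]_(y in B x t) `|f y|%:E <= (N * phi s * t `^ Q)%:E)%E) ->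
  (\int[mu]_y `|riesz_kernel d Q alpha f x y| <=
    (hedberg_const Cs * (N `^ (1 - beta) * a `^ beta))%:E)%E.
Proof.
move=> mf a0 N0 b01 Cs0 phi0 mphi HT Ha HN.
have nc0 := near_const_gt0.
have fc0 : 0 < 2 * 2 `^ Q :> R by rewrite mulr_gt0 ?powR_gt0.
have T0 t : 0 < t ->
    (0 <= \int[lebesgue_measure]_(r in `]t, +oo[) (r `^ alpha * phi r / r)%:E)%E.
  move=> t0; apply: integral_ge0 => r; rewrite /= in_itv/= andbT => /(lt_trans t0) r0.
  by rewrite lee_fin !mulr_ge0 ?powR_ge0 ?invr_ge0// ltW// phi0.
apply: (hedberg_balance _ a0 N0 _ b01 Cs0 phi0 T0 HT) => [||r r0].
- exact: addr_gt0.
- by case/andP: aQ.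
have mK : measurable_fun setT (fun y => `|riesz_kernel d Q alpha f x y|%E).
  by apply: measurableT_comp => //; exact: (measurable_riesz_kernel Q alpha dq mball).
rewrite -(setUv (B x r)) ge0_integral_setU//; last 4 first.
- exact: mball.
- exact/measurableC/mball.
- exact: measurable_funTS.
- by apply/disj_setPCl.
apply: leeD.
  apply: le_trans (riesz_near dq mball aQ mf a0 r0 Ha) _.
  rewrite lee_fin ler_wpM2r ?mulr_ge0 ?powR_ge0 ?(ltW a0)//.
  by rewrite -/near_const lerDl ltW.
apply: le_trans (riesz_far dq mball aQ mf N0 r0 phi0 mphi HN) _.
apply: lee_pmul => //; first by rewrite lee_fin mulr_ge0// ltW.
  exact: T0.
by rewrite lee_fin ler_wpM2r ?(ltW N0)// lerDr ltW.
Qed.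

End hedberg_selection.

(** * Integrability from weak type bounds *)

Section weak_integrability.
Context (R : realType) (disp : measure_display) (X : measurableType disp).
Variable mu : {measure set X -> \bar R}.

(** The points where the potential fails to converge absolutely form a set controlled in outer
    measure only. Intersecting covers of mass below 1/(n+1) supplies the measurable null superset
    that an almost everywhere statement requires. *)
Lemma mu_ext_negligible (A : set X) : (mu^*)%mu A = 0%E -> mu.-negligible A.
Proof.
move=> A0.
have cov (n : nat) : {F : nat -> set X | measurable_cover A F &
    (\sum_(k <oo) mu (F k) < n.+1%:R^-1%:E)%E}.
  have : ((mu^*)%mu A < n.+1%:R^-1%:E)%E by rewrite A0 lte_fin invr_gt0.
  by move=> /ereal_inf_lt H; apply: cid2; case: H => _ [F HF <-] ?; exists F.
pose F n := s2val (cov n).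
have FA n : measurable_cover A (F n) by rewrite /F; case: (cov n).
have Fn n : (\sum_(k <oo) mu (F n k) < n.+1%:R^-1%:E)%E.
  by rewrite /F; case: (cov n).
have mF n k : measurable (F n k) by have [+ _] := FA n; exact.
have mU n : measurable (\bigcup_k F n k) by apply: bigcup_measurable.
exists (\bigcap_n \bigcup_k F n k); split.
- by apply: bigcap_measurable => //; exists 0%N.
- apply/eqP; rewrite eq_le measure_ge0 andbT; apply/lee_addgt0Pr => e e0.
  rewrite add0e; set n := Num.truncn e^-1.
  apply: (@le_trans _ _ (mu (\bigcup_k F n k))).
    apply: le_measure; rewrite ?inE//.
      by apply: bigcap_measurable => //; exists 0%N.
    exact: bigcap_inf.
  apply: (@le_trans _ _ (\sum_(k <oo) mu (F n k))%E).
    exact: measure_sigma_subadditive.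
  apply: le_trans (ltW (Fn n)) _; rewrite lee_fin invf_ple ?posrE// ltW//.
  exact: truncnS_gt.
- by move=> x Ax n _; have [_] := FA n; exact.
Qed.

(** Dyadic layers: |h| is at most 2L on [A] plus the sum of 2^(k+2) L over the level sets at 2^k L.
    The weak bound makes that sum geometric of ratio 2 / 2^b, so decay of order [b > 1] is what
    gives convergence. *)
Lemma weak_type_integrable (h : X -> \bar R) (A : set X) (b c L : R) :
  measurable_fun setT h -> measurable A -> (mu A < +oo)%E ->
  (forall x, h x != 0%E -> A x) -> 0 < L -> 0 < c -> 1 < b ->
  (forall u, 1 <= u ->
    ((c * u `^ b)%:E * (mu^*)%mu [set x | ((u * L)%:E < `|h x|)%E] <= 1)%E) ->
  (\int[mu]_x `|h x| < +oo)%E.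
Proof.
move=> mh mA Afin hA L0 c0 b1 H.
pose G k := [set x | ((2 ^+ k * L)%:E < `|h x|)%E].
have mabs : measurable_fun setT (fun x => `|h x|%E) by exact: measurableT_comp.
have mG k : measurable (G k).
  by have := emeasurable_fun_o_infty measurableT mabs (2 ^+ k * L)%:E; rewrite setTI.
(* Values in [2^(k+1) L, 2^(k+2) L[ are charged to [G k]; starting one dyadic step above its
   threshold makes membership strict. *)
pose u k := cst (2 ^+ k.+2 * L)%:E \_ (G k).
have u0 k x : (0 <= u k x)%E.
  by apply: erestrict_ge0 => y _; rewrite lee_fin mulr_ge0 ?exprn_ge0// ltW.
have mu_ k : measurable_fun setT (u k).
  by apply/(measurable_restrictT _ _).1 => //; exact: measurable_cst.
pose v := cst (2 * L)%:E \_ A.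
have v0 x : (0 <= v x)%E.
  by apply: erestrict_ge0 => y _; rewrite lee_fin mulr_ge0// ltW.
have mv : measurable_fun setT v.
  by apply/(measurable_restrictT _ _).1 => //; exact: measurable_cst.
have mS : measurable_fun setT (fun x => \sum_(k <oo) u k x)%E.
  by apply: ge0_emeasurable_sum => //.
have S0 x : (0 <= \sum_(k <oo) u k x)%E by apply: nneseries_ge0.
have p2 k : 0 < 2 ^+ k :> R by rewrite exprn_gt0.
have real_bound x r : (r%:E <= `|h x|)%E -> (r%:E <= v x + \sum_(k <oo) u k x)%E.
  move=> rh; have [r2|r2] := leP r (2 * L).
    have [r0|r0] := leP r 0; first by rewrite (le_trans _ (adde_ge0 (v0 x) (S0 x))).
    apply: (@le_trans _ _ (v x)); last by rewrite leeDl.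
    rewrite /v patchE mem_set//; apply: hA.
    apply: contraTneq rh => ->; rewrite abse0 lee_fin -ltNge//.
  have L20 : 0 < 2 * L by rewrite mulr_gt0.
  have /dyadic_bracket[k /andP[k1 k2]] : 1 <= r / (2 * L).
    by rewrite ler_pdivlMr// mul1r ltW.
  apply: (@le_trans _ _ (\sum_(k <oo) u k x)%E); last by rewrite leeDr.
  apply: le_trans (nneseries_lim_ge k.+1 _); last by [].
  rewrite big_nat_recr//= -[leLHS]add0e; apply: leeD; first exact: sume_ge0.
  rewrite /u patchE mem_set.
    rewrite lee_fin; move: k2; rewrite ltr_pdivrMr// => /ltW/le_trans; apply.
    by rewrite [in leRHS]exprSr mulrA.
  rewrite /G/=; apply: lt_le_trans rh; rewrite lte_fin.
  move: k1; rewrite ler_pdivlMr// => /(lt_le_trans _); apply.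
  by rewrite mulrCA ltr_pMl ?mulr_gt0// ltr1n.
have bound x : (`|h x| <= v x + \sum_(k <oo) u k x)%E.
  have := abse_ge0 (h x); move: (real_bound x).
  case: (`|h x|)%E => [r| |//]; first by move=> + _; exact.
  move=> H1 _; rewrite leye_eq; apply/eqP/eqyP => r r0.
  by apply: H1; rewrite leey.
apply: (@le_lt_trans _ _ (\int[mu]_x (v x + \sum_(k <oo) u k x))%E).
  by apply: ge0_le_integral => //; exact: emeasurable_funD.
rewrite ge0_integralD// integral_nneseries//.
apply: lte_add_pinfty.
  rewrite /v -integral_mkcond integral_cst// lte_mul_pinfty// lee_fin.
  by rewrite mulr_ge0// ltW.
set w : R := 2 / 2 `^ b.
have w01 : 0 < w < 1.
  rewrite divr_gt0 ?powR_gt0//= ltr_pdivrMr ?powR_gt0// mul1r.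
  have : 1 `^ (b - 1) < 2 `^ (b - 1) :> R.
    by rewrite gt0_ltr_powR ?nnegrE ?subr_gt0// ltr1n.
  by rewrite powR1 powRB ?pnatr_eq0 ?implybT// powRr1// ltr_pdivlMr// mul1r.
apply: (@le_lt_trans _ _ (\sum_(k <oo) (4 * L / c * w ^+ k)%:E)%E); last first.
  apply: le_lt_trans (nneseries_geometric_le _ w01) _; last by rewrite ltry.
  by rewrite divr_ge0 ?mulr_ge0// ltW.
apply: lee_nneseries => [k _ _|k _]; first exact: integral_ge0.
rewrite /u -integral_mkcond integral_cst//.
have := H (2 ^+ k); rewrite exprn_ege1 ?ler1n// => /(_ isT).
rewrite -/(G k) measurable_mu_extE// powR_exprn//.
have b20 : 0 < (2 `^ b) ^+ k by rewrite exprn_gt0// powR_gt0.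
have cb0 : 0 < c * (2 `^ b) ^+ k by exact: mulr_gt0.
rewrite muleC -lee_pdivlMr// mul1e => Hk.
apply: le_trans (lee_wpmul2l _ Hk) _; first by rewrite lee_fin mulr_ge0 ?ltW.
rewrite -EFinM lee_fin /w expr_div_n !exprS invfM.
by rewrite le_eqVlt; apply/orP; left; apply/eqP; lra.
Qed.
End weak_integrability.

(** * Maximal bounds on Orlicz-Morrey spaces *)

Section morrey.
Context (R : realType) (disp : measure_display) (X : topMeasurableType disp).
Variables (d : X -> X -> R) (mu : {measure set X -> \bar R}) (K1 K3 Q : R).
Hypotheses (dq : quasi_distance d K1) (K11 : 1 <= K1) (K31 : 1 <= K3)
  (Q0 : 0 < Q)
  (mball : forall x r, 0 < r -> measurable (qball d x r))
  (hmu : forall x r, 0 < r ->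
    ((K3^-1 * r `^ Q)%:E <= mu (qball d x r) <= (K3 * r `^ Q)%:E)%E).
Variables (Phi : R -> \bar R) (P : R -> R).
Hypotheses (sP : starshaped P) (PhiE : represents P Phi).
Variable phi : R -> R.
Hypothesis phi0 : forall r, 0 < r -> 0 < phi r.

Local Notation B := (qball d).
Local Notation rinv := (rinv Phi).
Local Notation vol := (vol d mu).

Let K30 : 0 < K3. Proof. exact: lt_le_trans K31. Qed.
Let Pgt0 r : 0 < r -> 0 < P r. Proof. by case: sP => _ + _; exact. Qed.

Lemma young_inv_vol x r : 0 < r ->
  young_inv Phi (mu (B x r))^-1 = (rinv (vol x r)^-1)%:E.
Proof.
move=> r0; have v0 := vol_gt0 K31 hmu x r0.
rewrite (volE hmu)// inver gt_eqF// (rinvE sP PhiE)// invr_gt0//.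
Qed.

Let rQ0 r : 0 < r -> 0 < r `^ (- Q). Proof. exact: powR_gt0. Qed.

Lemma rinv_powR_le x r : 0 < r -> rinv (r `^ (- Q)) <= K3 * rinv (vol x r)^-1.
Proof.
move=> r0; have v0 := vol_gt0 K31 hmu x r0.
have vi0 : 0 < (vol x r)^-1 by rewrite invr_gt0.
apply: le_trans (rinv_scale sP PhiE K31 vi0).
apply: (le_rinv2 sP PhiE (rQ0 r0)).
rewrite ler_pdivlMr// powRN mulrC ler_pdivrMr ?powR_gt0//.
by case/andP: (vol_bounds hmu x r0).
Qed.

Lemma rinv_vol_le x r : 0 < r -> rinv (vol x r)^-1 <= K3 * rinv (r `^ (- Q)).
Proof.
move=> r0; have v0 := vol_gt0 K31 hmu x r0.
apply: le_trans (rinv_scale sP PhiE K31 (rQ0 r0)).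
apply: (le_rinv2 sP PhiE); first by rewrite invr_gt0.
rewrite powRN -[leRHS]invrK invfM invrK.
rewrite lef_pV2 ?posrE ?mulr_gt0 ?invr_gt0 ?powR_gt0//.
by case/andP: (vol_bounds hmu x r0).
Qed.

Lemma rinv_vol_gt0 x r : 0 < r -> 0 < rinv (vol x r)^-1.
Proof.
by move=> r0; apply: (rinv_gt0 sP PhiE); rewrite invr_gt0 (vol_gt0 K31 hmu).
Qed.

Lemma Luxemburg_le_integral (g : X -> R) l : measurable_fun setT g ->
  (LPhi_norm mu Phi g < l%:E)%E -> (\int[mu]_x Phi (`|g x| / l)%R <= 1)%E.
Proof.
move=> mg /ereal_inf_lt[_ [k [k0 Hk] <-]]; rewrite lte_fin => kl.
have l0 := lt_trans k0 kl.
apply: le_trans Hk; apply: ge0_le_integral => //.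
- by move=> x _; exact: (Phi_ge0 sP PhiE).
- exact: (measurable_Young sP PhiE).
- exact: (measurable_Young sP PhiE).
- move=> x _; rewrite !PhiE ?divr_ge0 ?(ltW l0) ?(ltW k0)// lee_fin.
  apply: starshaped_le => //; first by rewrite divr_ge0// ltW.
  by rewrite ler_wpM2l// lef_pV2 ?posrE// ltW.
Qed.

Lemma Luxemburg_ball_le (f : X -> R) x t s : measurable_fun setT f ->
  0 < t -> t <= s ->
  (LPhi_norm mu Phi (f \_ (B x t)) <= LPhi_norm mu Phi (f \_ (B x s)))%E.
Proof.
move=> mf t0 ts; have s0 := lt_le_trans t0 ts.
have mr r : 0 < r -> measurable_fun setT (f \_ (B x r)).
  move=> r0; apply/(measurable_restrictT _ _).1; first exact: mball.
  exact: measurable_funTS.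
apply: le_ereal_inf => _ [l [l0 Hl] <-]; exists l => //; split => //.
apply: le_trans Hl; apply: ge0_le_integral => //.
- by move=> y _; exact: (Phi_ge0 sP PhiE).
- by apply: (measurable_Young sP PhiE) => //; exact: mr.
- by apply: (measurable_Young sP PhiE) => //; exact: mr.
- move=> y _; rewrite !PhiE ?divr_ge0 ?(ltW l0)// lee_fin.
  apply: starshaped_le => //; first by rewrite divr_ge0// ltW.
  rewrite ler_wpM2r ?invr_ge0 ?(ltW l0)// !patchE.
  case: ifPn => [|_]; last by rewrite normr0.
  rewrite inE => yt; rewrite mem_set//; exact: lt_le_trans ts.
Qed.

Lemma LPhi_norm_ge0 (g : X -> R) : (0 <= LPhi_norm mu Phi g)%E.
Proof.
by apply: le_ereal_inf_tmp => _ [l [l0 _] <-]; rewrite lee_fin ltW.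
Qed.

Lemma M_norm_ge0 f : (0 <= M_norm d mu Phi phi f)%E.
Proof.
apply: ereal_sup_ge; eexists; first by exists (point, 1); rewrite /=.
rewrite /= mule_ge0 ?LPhi_norm_ge0// young_inv_vol// -EFinM lee_fin.
by rewrite mulr_ge0 ?invr_ge0 ?(ltW (phi0 _)) ?(ltW (rinv_vol_gt0 _ _)).
Qed.

(* [c] stands for a quantity that increases with the radius, frozen at radius [t].
   This is all that is used of the condition on [phi] in part 1, and it also
   holds for [phi] in the class G. *)
Definition dominated (C : R) : Prop := forall t c, 0 < t -> 0 <= c ->
  (forall s, t <= s -> c <= phi s / rinv (s `^ (- Q))) ->
  forall r, 0 < r < t -> rinv (t `^ (- Q)) * c <= C * phi r.

Section bounds.
Variable C : R.
Hypotheses (C0 : 0 < C) (hC : dominated C).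

(** The norm over balls centred at [x] grows with the radius, so its value at [t] is a legitimate
    frozen quantity for [dominated], which trades phi(t) for phi(r). The factor 2 leaves strict room
    above the infimum defining the norm. *)
Lemma morrey_local f (N : R) x r t : M_space d mu Phi phi f -> 0 < N ->
  (M_norm d mu Phi phi f < N%:E)%E -> 0 < r < t ->
  (\int[mu]_y Phi
    (`|(f \_ (B x t)) y| / (2 * K3 * C * N * phi r / rinv (t `^ (- Q))))%R <= 1)%E.
Proof.
move=> Mf N0 HN rt; have [r0 rt'] := andP rt; have t0 := lt_trans r0 rt'.
have mf := M_space_measurable mball Mf.
pose L s := LPhi_norm mu Phi (f \_ (B x s)).
have L0 s : (0 <= L s)%E by exact: LPhi_norm_ge0.
have q0 s : 0 < s -> 0 < rinv (s `^ (- Q)).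
  by move=> s0; apply: (rinv_gt0 sP PhiE); exact: rQ0.
have Lle s : 0 < s -> (L s <= (N * K3 * (phi s / rinv (s `^ (- Q))))%:E)%E.
  move=> s0.
  have : ((phi s)^-1%:E * young_inv Phi (mu (B x s))^-1 * L s < N%:E)%E.
    apply: le_lt_trans HN; apply: ereal_sup_ubound.
    by exists (x, s).
  rewrite young_inv_vol// -EFinM => /ltW.
  have ri0 := rinv_vol_gt0 x s0.
  rewrite muleC -lee_pdivlMr ?mulr_gt0 ?invr_gt0 ?phi0// => /le_trans; apply.
  rewrite -EFinM lee_fin -[leRHS]mulrA ler_pM2l// invfM invrK mulrCA ler_pM2l ?phi0//.
  rewrite ler_pdivlMr ?q0// mulrC ler_pdivrMr//.
  exact: rinv_powR_le.
have Lfin : L t \is a fin_num.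
  by rewrite ge0_fin_numE//; apply: le_lt_trans (Lle _ t0) _; rewrite ltry.
apply: Luxemburg_le_integral.
  apply/(measurable_restrictT _ _).1; first exact: mball.
  exact: measurable_funTS.
rewrite -/(L t) -(fineK Lfin) lte_fin.
have NK0 : 0 < N * K3 by exact: mulr_gt0.
have : rinv (t `^ (- Q)) * (fine (L t) / (N * K3)) <= C * phi r.
  apply: hC rt => //; first by rewrite divr_ge0 ?fine_ge0// ltW.
  move=> s ts; have s0 := lt_le_trans t0 ts.
  rewrite ler_pdivrMr// mulrC -lee_fin fineK//.
  apply: le_trans (Lle _ s0).
  exact: Luxemburg_ball_le.
rewrite mulrA ler_pdivrMr// => H.
rewrite ltr_pdivlMr ?q0// mulrC; apply: le_lt_trans H _.
rewrite -[ltRHS]mulr1 -!mulrA.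
have : 0 < C * phi r * (N * K3) by rewrite !mulr_gt0// phi0.
lra.
Qed.

(** The inverse Young function in [morrey_local] cancels against the one in [orlicz_average]. The
    constant is 4 from the latter, [2 * K3 * C] from the former, and two factors [K3] from comparing
    mu(B) with t^Q. *)
Lemma morrey_average : exists2 C1, 0 < C1 & forall f (N : R),
  M_space d mu Phi phi f -> 0 < N -> (M_norm d mu Phi phi f < N%:E)%E ->
  forall x s t, 0 < s < t ->
  (\int[mu]_(y in B x t) `|f y|%:E <= (C1 * N * phi s * t `^ Q)%:E)%E.
Proof.
exists (8 * K3 * K3 * K3 * C); first by rewrite !mulr_gt0.
move=> f N Mf N0 HN x s t st; have [s0 st'] := andP st; have t0 := lt_trans s0 st'.
have mf := M_space_measurable mball Mf.
have q0 : 0 < rinv (t `^ (- Q)) by apply: (rinv_gt0 sP PhiE); exact: rQ0.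
have p0 := phi0 s0.
have l0 : 0 < 2 * K3 * C * N * phi s / rinv (t `^ (- Q)).
  by rewrite divr_gt0// !mulr_gt0.
have H := orlicz_average K31 mball hmu sP PhiE t0 l0 mf
  (morrey_local x Mf N0 HN st).
apply: le_trans H _; rewrite lee_fin.
have v0 := vol_gt0 K31 hmu x t0; have ri0 := rinv_vol_gt0 x t0.
have H1 := rinv_vol_le x t0.
have H2 : vol x t <= K3 * t `^ Q by case/andP: (vol_bounds hmu x t0).
have H3 := ler_pM (ltW ri0) (ltW v0) H1 H2.
set l := _ / _ in l0 *.
have -> : 8 * K3 * K3 * K3 * C * N * phi s * t `^ Q =
    4 * l * ((K3 * rinv (t `^ (- Q))) * (K3 * t `^ Q)).
  have : l * rinv (t `^ (- Q)) = 2 * K3 * C * N * phi s by rewrite /l divfK// gt_eqF.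
  move: (l) => l1 Hl.
  transitivity (4 * K3 * K3 * t `^ Q * (l1 * rinv (t `^ (- Q)))); last by lra.
  rewrite Hl; lra.
by rewrite -[leLHS]mulrA ler_pM2l //; apply: mulr_gt0.
Qed.

Lemma morrey_weak_type : exists2 c0, 0 < c0 & forall f (N : R),
  M_space d mu Phi phi f -> 0 < N -> (M_norm d mu Phi phi f < N%:E)%E ->
  forall x r a, 0 < r -> 0 < a ->
  ((P (a / (c0 * N * phi r / rinv (vol x r)^-1)))%:E *
   (mu^*)%mu [set y | B x r y /\ large_average d mu Q f a y] <= 1)%E.
Proof.
have [C1 C10 HC1] := morrey_average.
have K10 : 0 < K1 by exact: lt_le_trans K11.
have W0 := weak_const_gt0 Q K11 K31.
set W := weak_const K1 K3 Q in W0.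
(* Bounds the change of Phi^-1(r^-Q) when the radius grows from [r] to [2 * K1 * r]. *)
pose D := (2 * K1) `^ Q.
have D1 : 1 <= D.
  have : 1 `^ Q <= (2 * K1) `^ Q.
    rewrite ge0_ler_powR ?nnegrE ?mulr_ge0 ?(ltW Q0) ?(ltW K10)//.
    by have := K11; lra.
  by rewrite powR1.
have D0 : 0 < D by exact: lt_le_trans D1.
pose c2 := 4 * K3 * K3 * K3 * C * (W + 1) * D.
have W10 : 0 < W + 1 by rewrite addr_gt0.
have c20 : 0 < c2 by rewrite !mulr_gt0.
have C12 : 0 < 2 * C1 by rewrite mulr_gt0.
exists (2 * C1 + c2); first exact: addr_gt0.
move=> f N Mf N0 HN x r a r0 a0.
have mf := M_space_measurable mball Mf.
have p0 := phi0 r0; have v0 := vol_gt0 K31 hmu x r0.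
have ri0 := rinv_vol_gt0 x r0.
set q := rinv _ in ri0 *.
set lam := _ / q.
have lam0 : 0 < lam by rewrite divr_gt0// !mulr_gt0// addr_gt0.
set E := [set y | _].
have al0 : 0 <= a / lam by rewrite divr_ge0// ltW.
(* For low [a] the whole ball is an affordable bound: [a / lam] lies below Phi^-1 of the inverse
   volume, so [P] there is at most the inverse volume. *)
have [aC|Ca] := leP a (C1 * N * phi r).
  apply: (@le_trans _ _ ((vol x r)^-1%:E * mu (B x r))%E); last first.
    by rewrite (volE hmu)// -EFinM mulVf// gt_eqF.
  apply: lee_pmul => //.
  - by rewrite lee_fin starshaped_ge0.
  - exact: mu_ext_ge0.
  - rewrite lee_fin; apply: (le_rinv sP PhiE _ al0); first by rewrite invr_gt0.
    rewrite -/q ltr_pdivrMr// /lam mulrCA mulfV ?gt_eqF// mulr1.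
    apply: (le_lt_trans aC); rewrite !ltr_pM2r//; lra.
  - rewrite -(measurable_mu_extE mu (mball x r0)); apply: le_mu_ext.
    by move=> y [].
(* For high [a], [morrey_average] rules out radii above [r]. The remaining balls have centre in
   [B x r] and lie in [B x t], so [f] may be cut off there. *)
pose t := 2 * K1 * r.
have t0 : 0 < t by rewrite !mulr_gt0.
have rt : 0 < r < t.
  by rewrite r0 /t ltr_pMl//; have := K11; lra.
pose l := 2 * K3 * C * N * phi r / rinv (t `^ (- Q)).
have q't : 0 < rinv (t `^ (- Q)) by apply: (rinv_gt0 sP PhiE); exact: rQ0.
have l0 : 0 < l by rewrite divr_gt0// !mulr_gt0.
pose f1 := f \_ (B x t).
have mf1 : measurable_fun setT f1.
  apply/(measurable_restrictT _ _).1; first exact: mball.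
  exact: measurable_funTS.
have Hw := orlicz_weak_type dq K11 K31 Q0 mball hmu sP PhiE l0 a0 mf1
  (morrey_local x Mf N0 HN rt).
have EE : E `<=` [set y | large_average d mu Q f1 a y].
  move=> y [xy [s s0 Hs]]; exists s => //; apply: (lt_le_trans Hs).
  have [sr|rs] := leP s r; last first.
    exfalso; move: (HC1 f N Mf N0 HN y r s).
    rewrite r0 rs => /(_ isT) H; have := lt_le_trans Hs H.
    rewrite lte_fin ltr_pM2r ?powR_gt0// => /lt_trans/(_ Ca).
    by rewrite ltxx.
  rewrite le_eqVlt; apply/orP; left; apply/eqP; apply: eq_integral => z.
  rewrite inE => yz; rewrite /f1 patchE mem_set//.
  apply: (le_lt_trans (qdist_triangle dq _ _ y)).
  rewrite /t [2 * K1]mulrC -mulrA ltr_pM2l//.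
  by move: xy yz; rewrite /qball/=; lra.
set b := a / (2 * K3 * l) in Hw.
have K3l0 : 0 < 2 * K3 * l by apply: mulr_gt0 => //; apply: mulr_gt0.
have b0 : 0 < b by exact: divr_gt0.
have lamb : a / lam <= b / (W + 1).
  have K3lW : 0 < 2 * K3 * l * (W + 1) by exact: mulr_gt0.
  rewrite /b -mulrA -invfM ler_pM2l// lef_pV2 ?posrE//.
  rewrite /lam ler_pdivlMr// /l.
  have H : q <= K3 * D * rinv (t `^ (- Q)).
    apply: le_trans (rinv_vol_le x r0) _; rewrite -mulrA ler_pM2l//.
    apply: le_trans (rinv_scale sP PhiE D1 (rQ0 t0)).
    rewrite le_eqVlt; apply/orP; left; apply/eqP; congr rinv.
    have k0 : 0 < 2 * K1 by exact: mulr_gt0.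
    rewrite /D /t (@powRM _ (2 * K1)) ?(ltW r0) ?(ltW k0)// mulrA -powRD.
      by rewrite subrr powRr0 mul1r.
    by rewrite subrr eqxx/= gt_eqF.
  set qt := rinv (t `^ (- Q)) in q't H *.
  have H' : qt^-1 * q <= K3 * D by rewrite mulrC ler_pdivrMr.
  have cc : 0 < 4 * K3 * K3 * C * N * phi r * (W + 1) by rewrite !mulr_gt0.
  have := ler_wpM2l (ltW cc) H'.
  have e1 : 0 <= 2 * C1 * N * phi r by rewrite !mulr_ge0// ltW.
  rewrite /c2; lra.
(* The weak type constant is absorbed into the argument: P(b / (W+1)) is at most P(b) / (W+1). Using
   [W + 1] keeps the divisor at least 1. *)
apply: (@le_trans _ _ ((P b / (W + 1))%:E * (mu^*)%mu E)%E).
  apply: lee_pmul => //.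
  - by rewrite lee_fin starshaped_ge0.
  - exact: mu_ext_ge0.
  - rewrite lee_fin; apply: le_trans (starshaped_le sP al0 lamb) _.
    case: sP => _ _ /(_ (W + 1)^-1 b); rewrite ![_^-1 * _]mulrC; apply.
      by rewrite invr_ge0 (ltW W10) invf_le1// lerDr ltW.
    exact: ltW.
rewrite mulrC EFinM -muleA lee_pdivrMl// mule1.
apply: (@le_trans _ _ W%:E); last by rewrite lee_fin lerDl.
apply: le_trans Hw; apply: lee_pmul => //.
- by rewrite lee_fin starshaped_ge0// ltW.
- exact: mu_ext_ge0.
- exact: le_mu_ext.
Qed.

End bounds.
End morrey.

(** * Sufficiency *)

Section sufficiency.
Context (R : realType) (disp : measure_display) (X : topMeasurableType disp).
Variables (d : X -> X -> R) (mu : {measure set X -> \bar R}) (K1 K3 Q : R).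
Hypotheses (dq : quasi_distance d K1) (K11 : 1 <= K1) (K31 : 1 <= K3)
  (Q0 : 0 < Q)
  (mball : forall x r, 0 < r -> measurable (qball d x r))
  (hmu : forall x r, 0 < r ->
    ((K3^-1 * r `^ Q)%:E <= mu (qball d x r) <= (K3 * r `^ Q)%:E)%E).
Variables (Phi : R -> \bar R) (P : R -> R).
Hypotheses (sP : starshaped P) (PhiE : represents P Phi).
Variable phi : R -> R.
Hypothesis phi0 : forall r, 0 < r -> 0 < phi r.

Local Notation B := (qball d).
Local Notation rinv := (rinv Phi).
Local Notation vol := (vol d mu).

Let Pgt0 r : 0 < r -> 0 < P r. Proof. by case: sP => _ + _; exact. Qed.

(** This identity lets a scale l^beta for [Psi] act as the scale [l] for [Phi]. *)
Lemma powR_div_powRK (b u l : R) : 0 < b -> 0 <= u -> 0 < l ->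
  (u / l `^ b) `^ b^-1 = u `^ b^-1 / l.
Proof.
move=> b0 u0 l0; rewrite powRM// ?invr_ge0 ?powR_ge0//; congr (_ * _).
rewrite -powRN -powRrM mulNr mulfV ?gt_eqF// powR_inv1//.
exact: ltW.
Qed.

Lemma powR_inv_powRK (b u : R) : 0 < b -> 0 <= u -> (u `^ b^-1) `^ b = u.
Proof. by move=> b0 u0; rewrite -powRrM mulVf ?gt_eqF// powRr1. Qed.

Variables (alpha beta C Cs : R).
Hypotheses (aQ : 0 < alpha < Q) (b01 : 0 < beta < 1)
  (mphi : measurable_fun (`]0, +oo[ : set R) phi)
  (C0 : 0 < C) (hC : dominated Q Phi phi C) (Cs0 : 0 < Cs)
  (hT : forall t, 0 < t ->
    ((t `^ alpha * phi t)%:E +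
     \int[lebesgue_measure]_(r in `]t, +oo[) (r `^ alpha * phi r / r)%:E <=
     (Cs * phi t `^ beta)%:E)%E).

Let Psi t := Phi (t `^ beta^-1).
Let eta t := phi t `^ beta.
Let H := hedberg_const Q alpha Cs.

Lemma integral_riesz_kernel_le (C1 N : R) (f : X -> R) x (a : R) : 0 < C1 -> 0 < N ->
  measurable_fun setT f ->
  (forall x s t, 0 < s < t ->
    (\int[mu]_(y in B x t) `|f y|%:E <= (C1 * N * phi s * t `^ Q)%:E)%E) ->
  0 < a -> ~ large_average d mu Q f a x ->
  (\int[mu]_y `|riesz_kernel d Q alpha f x y| <=
    (H * ((C1 * N) `^ (1 - beta) * a `^ beta))%:E)%E.
Proof.
move=> C10 N0 mf HC1 a0 xa.
apply: (riesz_hedberg dq mball aQ mf a0 (mulr_gt0 C10 N0) b01 Cs0 phi0 mphi hT).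
- by move=> t t0; rewrite leNgt; apply/negP => ta; apply: xa; exists t.
- exact: HC1.
Qed.

Lemma distr_riesz_le (C1 c0 N : R) (f : X -> R) x (r t : R) :
  0 < C1 -> 0 < c0 -> 0 < N -> measurable_fun setT f ->
  (forall x s t, 0 < s < t ->
    (\int[mu]_(y in B x t) `|f y|%:E <= (C1 * N * phi s * t `^ Q)%:E)%E) ->
  (forall x r a, 0 < r -> 0 < a ->
    ((P (a / (c0 * N * phi r / rinv (vol x r)^-1)))%:E *
     (mu^*)%mu [set y | B x r y /\ large_average d mu Q f a y] <= 1)%E) ->
  0 < r -> 0 < t ->
  (Psi (t / (H * ((C1 * N) `^ (1 - beta) *
               (c0 * N * phi r / rinv (vol x r)^-1) `^ beta))) *
    distr mu (riesz d mu Q alpha f \_ (B x r)) t <= 1)%E.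
Proof.
move=> C10 c00 N0 mf HC1 Hc0 r0 t0.
have [b0 b1] := andP b01.
have ri0 := rinv_vol_gt0 K31 hmu sP PhiE x r0.
have H0 : 0 < H by exact: hedberg_const_gt0.
set lam := _ / rinv _.
have lam0 : 0 < lam by rewrite divr_gt0// !mulr_gt0// phi0.
have k0 : 0 < H * (C1 * N) `^ (1 - beta) by rewrite mulr_gt0// powR_gt0 ?mulr_gt0.
set k := H * (C1 * N) `^ (1 - beta) in k0.
rewrite mulrA -/k.
have tk0 : 0 < t / k by exact: divr_gt0.
(* The height at which Hedberg's bound equals [t] exactly: where |I_alpha f| exceeds [t], the
   average must be large at height [a]. *)
pose a := (t / k) `^ beta^-1.
have a0 : 0 < a by rewrite powR_gt0.
have ka : H * ((C1 * N) `^ (1 - beta) * a `^ beta) = t.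
  by rewrite mulrA -/k /a powR_inv_powRK ?(ltW tk0)// mulrC divfK// gt_eqF.
have -> : t / (k * lam `^ beta) = (t / k) / lam `^ beta by rewrite invfM mulrA.
have al0 : 0 <= a / lam by exact: divr_ge0 (ltW a0) (ltW lam0).
rewrite /Psi powR_div_powRK ?(ltW tk0)// -/a PhiE//.
apply: le_trans (Hc0 x r a r0 a0); apply: lee_pmul => //.
- by rewrite lee_fin starshaped_ge0.
- exact: mu_ext_ge0.
apply: le_mu_ext => y /=; rewrite patchE; case: ifPn => [|_]; last first.
  by rewrite abse0 lte_fin ltNge (ltW t0).
rewrite inE => xy ty; split => //; apply: contrapT => ya.
have := integral_riesz_kernel_le C10 N0 mf HC1 a0 ya.
rewrite ka leNgt => /negP; apply; apply: (lt_le_trans ty).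
apply: le_abse_integral => //; exact: (measurable_riesz_kernel Q alpha dq mball).
Qed.

(** One finite height [a] suffices for absolute convergence at a point. Points large at every height
    have outer measure 0 in each ball, because [P] is unbounded. *)
Lemma riesz_kernel_integrable_ae (C1 c0 N : R) (f : X -> R) :
  0 < C1 -> 0 < c0 -> 0 < N -> measurable_fun setT f ->
  (forall x s t, 0 < s < t ->
    (\int[mu]_(y in B x t) `|f y|%:E <= (C1 * N * phi s * t `^ Q)%:E)%E) ->
  (forall x r a, 0 < r -> 0 < a ->
    ((P (a / (c0 * N * phi r / rinv (vol x r)^-1)))%:E *
     (mu^*)%mu [set y | B x r y /\ large_average d mu Q f a y] <= 1)%E) ->
  {ae mu, forall x, mu.-integrable setT (riesz_kernel d Q alpha f x)}.
Proof.
move=> C10 c00 N0 mf HC1 Hc0.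
pose Z m := [set x | B point m.+1%:R x /\ forall a, 0 < a -> large_average d mu Q f a x].
apply: (@negligibleS _ _ _ _ (\bigcup_m Z m)).
  move=> x xK.
  have : [set: X] x by []. rewrite -(ballT d point) => -[m _ xm].
  exists m => //; split => // a a0; apply: contrapT => xa; apply: xK.
  apply/integrableP; split; first exact: (measurable_riesz_kernel Q alpha dq mball).
  apply: le_lt_trans (integral_riesz_kernel_le C10 N0 mf HC1 a0 xa) _.
  by rewrite ltry.
apply: negligible_bigcup => m; apply: mu_ext_negligible.
have r0 : 0 < m.+1%:R :> R by [].
have ri0 := rinv_vol_gt0 K31 hmu sP PhiE point r0.
set lam := (c0 * N * phi m.+1%:R / rinv (vol point m.+1%:R)^-1).
have lam0 : 0 < lam by rewrite divr_gt0// !mulr_gt0// phi0.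
have P10 := Pgt0 ltr01.
apply/eqP; rewrite eq_le mu_ext_ge0// andbT; apply/lee_addgt0Pr => e e0.
(* At least linear growth gives P(k) >= k P(1) = P(1) + 1/e, hence 1/P(k) <= e. *)
rewrite add0e; set k := 1 + (e * P 1)^-1.
have eP0 : 0 < (e * P 1)^-1 by rewrite invr_gt0 mulr_gt0.
have k1 : 1 <= k by rewrite lerDl ltW.
have k0 : 0 < k by exact: lt_le_trans k1.
have := Hc0 point _ (k * lam) r0 (mulr_gt0 k0 lam0).
rewrite -/lam mulfK ?gt_eqF// => Hk.
have Pk0 := Pgt0 k0.
apply: (@le_trans _ _ (P k)^-1%:E); last first.
  rewrite lee_fin invf_ple ?posrE//.
  have := starshaped_scale sP k1 ler01; rewrite mulr1; apply: le_trans.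
  rewrite /k mulrDl invfM divfK ?gt_eqF// mul1r.
  by rewrite lerDr ltW.
rewrite -[leRHS]mule1 lee_pdivlMl//; apply: le_trans Hk.
apply: lee_pmul => //; [by rewrite lee_fin ltW|exact: mu_ext_ge0|].
by apply: le_mu_ext => y [xy ya]; split => //; apply: ya; exact: mulr_gt0.
Qed.

(** N^(1-beta) from Hedberg's inequality and N^beta from the weak type bound recombine to [N], while
    [eta] and the inverse Young function cancel. The factor 2^beta comes from the strict inequality
    in the definition of the inverse. *)
Lemma WM_norm_riesz_le (C1 c0 N : R) (f : X -> R) :
  0 < C1 -> 0 < c0 -> 0 < N -> measurable_fun setT f ->
  (forall x s t, 0 < s < t ->
    (\int[mu]_(y in B x t) `|f y|%:E <= (C1 * N * phi s * t `^ Q)%:E)%E) ->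
  (forall x r a, 0 < r -> 0 < a ->
    ((P (a / (c0 * N * phi r / rinv (vol x r)^-1)))%:E *
     (mu^*)%mu [set y | B x r y /\ large_average d mu Q f a y] <= 1)%E) ->
  (WM_norm d mu Psi eta (riesz d mu Q alpha f) <=
    (H * 2 `^ beta * C1 `^ (1 - beta) * c0 `^ beta * N)%:E)%E.
Proof.
move=> C10 c00 N0 mf HC1 Hc0; have [b0 b1] := andP b01.
apply: ge_ereal_sup => _ [[x r] /= r0 <-].
have H0 : 0 < H by exact: hedberg_const_gt0.
have p0 := phi0 r0.
have ri0 := rinv_vol_gt0 K31 hmu sP PhiE x r0.
have v0 := vol_gt0 K31 hmu x r0.
set q := rinv (vol x r)^-1 in ri0.
pose lam := c0 * N * phi r / q.
have lam0 : 0 < lam by rewrite divr_gt0// !mulr_gt0.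
pose Lam := H * ((C1 * N) `^ (1 - beta) * lam `^ beta).
have CN0 : 0 < C1 * N by exact: mulr_gt0.
have Lam0 : 0 < Lam by rewrite mulr_gt0// mulr_gt0 ?powR_gt0.
have norm_le : (WLPhi_norm mu Psi (riesz d mu Q alpha f \_ (B x r)) <= Lam%:E)%E.
  apply: ereal_inf_lbound; exists Lam => //; split => //.
  apply: ge_ereal_sup => _ [t /= t0 <-].
  exact: distr_riesz_le.
have inv_le : (young_inv Psi (mu (B x r))^-1 <= ((2 * q) `^ beta)%:E)%E.
  apply: young_inv_le; first exact: powR_ge0.
  have q20 : 0 < 2 * q by exact: mulr_gt0.
  rewrite /Psi -powRrM mulfV ?gt_eqF// powRr1 ?(ltW q20)// PhiE ?(ltW q20)//.
  rewrite (volE hmu)// inver gt_eqF// lte_fin.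
  apply: (rinv_lt sP PhiE); first by rewrite invr_gt0.
  by rewrite -/q ltr_pMl// ltr1n.
have norm_ge0 : (0 <= WLPhi_norm mu Psi (riesz d mu Q alpha f \_ (B x r)))%E.
  by apply: le_ereal_inf_tmp => _ [l [l0 _] <-]; rewrite lee_fin ltW.
have inv_ge0 : (0 <= young_inv Psi (mu (B x r))^-1)%E.
  by apply: le_ereal_inf_tmp => _ [l [l0 _] <-]; rewrite lee_fin.
apply: (@le_trans _ _ ((eta r)^-1%:E * ((2 * q) `^ beta)%:E * Lam%:E)%E).
  apply: lee_pmul => //.
    by rewrite mule_ge0// lee_fin invr_ge0 powR_ge0.
  apply: lee_pmul => //; by rewrite lee_fin invr_ge0 powR_ge0.
rewrite -!EFinM lee_fin /Lam /lam /eta.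
have Nb : N `^ (1 - beta) * N `^ beta = N.
  rewrite -powRD ?subrK ?powRr1 ?(ltW N0)//.
  by rewrite (gt_eqF N0) implybT.
have lamE : (c0 * N * phi r / q) `^ beta * q `^ beta =
    c0 `^ beta * N `^ beta * phi r `^ beta.
  rewrite -powRM ?(ltW lam0) ?(ltW ri0)// divfK ?gt_eqF//.
  by rewrite powRM ?mulr_ge0 ?(ltW c00) ?(ltW N0) ?(ltW p0)// powRM ?(ltW c00) ?(ltW N0).
have e0 : 0 < phi r `^ beta by rewrite powR_gt0.
rewrite powRM ?(ltW ri0)// (powRM _ (ltW C10) (ltW N0)).
rewrite -[X in _ <= _ * X]Nb.
move: lamE e0; move: ((c0 * N * phi r / q) `^ beta) (q `^ beta) (phi r `^ beta).
move=> u v e uv e0.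
rewrite le_eqVlt; apply/orP; left; apply/eqP.
transitivity (e^-1 * 2 `^ beta * H * C1 `^ (1 - beta) * N `^ (1 - beta) * (u * v)).
  lra.
rewrite uv; transitivity (2 `^ beta * H * C1 `^ (1 - beta) * N `^ (1 - beta) *
  c0 `^ beta * N `^ beta * (e / e)); first by lra.
rewrite divff ?gt_eqF//; lra.
Qed.

Lemma WLPhi_riesz (C1 c0 N : R) (f : X -> R) x (r : R) :
  0 < C1 -> 0 < c0 -> 0 < N -> measurable_fun setT f ->
  (forall x s t, 0 < s < t ->
    (\int[mu]_(y in B x t) `|f y|%:E <= (C1 * N * phi s * t `^ Q)%:E)%E) ->
  (forall x r a, 0 < r -> 0 < a ->
    ((P (a / (c0 * N * phi r / rinv (vol x r)^-1)))%:E *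
     (mu^*)%mu [set y | B x r y /\ large_average d mu Q f a y] <= 1)%E) ->
  0 < r -> measurable_fun setT (riesz d mu Q alpha f) ->
  WLPhi d mu Psi (riesz d mu Q alpha f \_ (B x r)).
Proof.
move=> C10 c00 N0 mf HC1 Hc0 r0 mI; have [b0 b1] := andP b01.
have H0 : 0 < H by exact: hedberg_const_gt0.
have p0 := phi0 r0.
have ri0 := rinv_vol_gt0 K31 hmu sP PhiE x r0.
pose lam := c0 * N * phi r / rinv (vol x r)^-1.
have lam0 : 0 < lam by rewrite divr_gt0// !mulr_gt0.
pose Lam := H * ((C1 * N) `^ (1 - beta) * lam `^ beta).
have CN0 : 0 < C1 * N by exact: mulr_gt0.
have Lam0 : 0 < Lam by rewrite mulr_gt0// mulr_gt0 ?powR_gt0.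
set h := riesz d mu Q alpha f \_ (B x r).
have hd t : 0 < t -> (Psi (t / Lam) * distr mu h t <= 1)%E.
  by move=> t0; exact: distr_riesz_le.
have mB : measurable (B x r) by exact: mball.
have mh : measurable_fun setT h.
  by apply/(measurable_restrictT _ _).1 => //; exact: measurable_funTS.
split.
  have ih : mu.-integrable setT h.
    apply/integrableP; split => //.
    (* For u >= 1, Psi(u) is at least P(1) u^(1/beta), and the exponent exceeds 1 because
       [beta < 1]. *)
    apply: (weak_type_integrable (A := B x r) (L := Lam) (b := beta^-1)
      (c := P 1) mh mB) => //.
    - by rewrite (volE hmu)// ltry.
    - by move=> y; rewrite /h patchE; case: ifPn; [rewrite inE|rewrite eqxx].
    - exact: Pgt0.
    - by rewrite invf_gt1.
    move=> u u1; have u0 : 0 < u by exact: lt_le_trans u1.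
    have := hd (u * Lam) (mulr_gt0 u0 Lam0); rewrite mulfK ?gt_eqF//.
    apply: le_trans; apply: lee_pmul => //.
    - by rewrite lee_fin mulr_ge0 ?powR_ge0// ltW// Pgt0.
    - exact: mu_ext_ge0.
    have ub1 : 1 <= u `^ beta^-1.
      have : 1 `^ beta^-1 <= u `^ beta^-1.
        by rewrite ge0_ler_powR ?nnegrE ?invr_ge0 ?(ltW b0) ?(ltW u0).
      by rewrite powR1.
    rewrite /Psi PhiE ?powR_ge0// lee_fin mulrC.
    by have := starshaped_scale sP ub1 ler01; rewrite mulr1.
  move=> x' r' r'0; apply: integrableS ih => //; exact: mball.
exists Lam^-1; first by rewrite invr_gt0.
apply: (@le_lt_trans _ _ 1%E); last by rewrite ltry.
apply: ge_ereal_sup => _ [t /= t0 <-].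
have := hd (t * Lam) (mulr_gt0 t0 Lam0); rewrite mulfK ?gt_eqF//.
congr (_ * _ <= _)%E; congr (mu_ext mu _); apply/seteqP.
have E y : (t%:E < `|(Lam^-1)%:E * h y|)%E = ((t * Lam)%:E < `|h y|)%E.
  rewrite abseM/= ger0_norm ?invr_ge0 ?(ltW Lam0)//.
  by rewrite lte_pdivlMl// -EFinM mulrC.
by split => y /=; rewrite E.
Qed.

Lemma riesz_bounded_sufficient : riesz_bounded d mu Q alpha Phi phi Psi eta.
Proof.
have [C1 C10 HC1] := morrey_average K31 mball hmu sP PhiE phi0 C0 hC.
have [c0 c00 Hc0] := morrey_weak_type dq K11 K31 Q0 mball hmu sP PhiE phi0 C0 hC.
have H0 : 0 < H by exact: hedberg_const_gt0.
pose C3 := H * 2 `^ beta * C1 `^ (1 - beta) * c0 `^ beta.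
have C30 : 0 < C3 by do 3![apply: mulr_gt0; last by rewrite powR_gt0].
exists C3 => // f Mf.
have mf := M_space_measurable mball Mf.
have M0 := M_norm_ge0 K31 hmu sP PhiE phi0 f.
have Mfin : M_norm d mu Phi phi f \is a fin_num.
  by rewrite ge0_fin_numE//; case: Mf.
set M := M_norm d mu Phi phi f in M0 Mfin *.
have m0 : 0 <= fine M by exact: fine_ge0.
have WMle : (WM_norm d mu Psi eta (riesz d mu Q alpha f) <= C3%:E * M)%E.
  rewrite -(fineK Mfin); apply/lee_addgt0Pr => e e0.
  (* The estimates ask for a positive [N] strictly above the norm; an excess of [e / C3] costs
     exactly [e], and a zero norm is covered too. *)
  have eC0 : 0 < e / C3 by exact: divr_gt0.
  have N0 : 0 < fine M + e / C3 by rewrite ltr_wpDl.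
  have MN : (M < (fine M + e / C3)%:E)%E.
    by rewrite -[ltLHS](fineK Mfin) lte_fin ltrDl.
  apply: le_trans (WM_norm_riesz_le C10 c00 N0 mf
    (HC1 f _ Mf N0 MN) (Hc0 f _ Mf N0 MN)) _.
  rewrite -/C3 -EFinM -EFinD lee_fin mulrDr [C3 * (e / _)]mulrC divfK ?gt_eqF//.
have N0 : 0 < fine M + 1 by rewrite ltr_wpDl.
have MN : (M < (fine M + 1)%:E)%E by rewrite -[ltLHS](fineK Mfin) lte_fin ltrDl.
have HC1f := HC1 f _ Mf N0 MN; have Hc0f := Hc0 f _ Mf N0 MN.
split => //.
- exact: riesz_kernel_integrable_ae C10 c00 N0 mf HC1f Hc0f.
- move=> mI; split.
    by move=> x r r0; exact: WLPhi_riesz C10 c00 N0 mf HC1f Hc0f r0 mI.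
  apply: le_lt_trans WMle _; rewrite -(fineK Mfin) -EFinM; exact: ltry.
Qed.

End sufficiency.

(** * Necessity *)

Section necessity.
Context (R : realType) (disp : measure_display) (X : topMeasurableType disp).
Variables (d : X -> X -> R) (mu : {measure set X -> \bar R}) (K1 K3 Q : R).
Hypotheses (dq : quasi_distance d K1) (K11 : 1 <= K1) (K31 : 1 <= K3)
  (Q0 : 0 < Q)
  (mball : forall x r, 0 < r -> measurable (qball d x r))
  (hmu : forall x r, 0 < r ->
    ((K3^-1 * r `^ Q)%:E <= mu (qball d x r) <= (K3 * r `^ Q)%:E)%E).
Variables (Phi : R -> \bar R) (P : R -> R).
Hypotheses (sP : starshaped P) (PhiE : represents P Phi).

Local Notation B := (qball d).
Local Notation rinv := (rinv Phi).
Local Notation vol := (vol d mu).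

Let K30 : 0 < K3. Proof. exact: lt_le_trans K31. Qed.
Let K10 : 0 < K1. Proof. exact: lt_le_trans K11. Qed.

Lemma integral_Phi_indic (E : set X) (k : R) : measurable E -> 0 <= k ->
  (\int[mu]_x Phi (k * `|(\1_E x : R)|)%R = (P k)%:E * mu E)%E.
Proof.
move=> mE k0; rewrite -integral_cst// integral_mkcond; apply: eq_integral => x _.
rewrite patchE indicE; case: ifPn => xE; first by rewrite normr1 mulr1 PhiE.
by rewrite normr0 mulr0 PhiE//; case: sP => ->.
Qed.

Lemma Luxemburg_indic_le (E : set X) (V : R) : measurable E -> 0 < V ->
  (mu E <= V%:E)%E ->
  (LPhi_norm mu Phi (\1_E : X -> R) <= (2 / rinv V^-1)%:E)%E.
Proof.
move=> mE V0 EV; have Vi0 : 0 < V^-1 by rewrite invr_gt0.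
have q0 := rinv_gt0 sP PhiE Vi0.
apply: ereal_inf_lbound; exists (2 / rinv V^-1) => //.
split; first by rewrite divr_gt0.
(* Half the infimum lies strictly below it, where [P] is at most [V^-1]. *)
set k := rinv V^-1 / 2.
have k0 : 0 <= k by rewrite divr_ge0// ltW.
under eq_integral do rewrite invf_div mulrC.
rewrite (integral_Phi_indic mE k0).
apply: (@le_trans _ _ (V^-1%:E * V%:E)%E).
  apply: lee_pmul => //; first by rewrite lee_fin starshaped_ge0.
  rewrite lee_fin; apply: (le_rinv sP PhiE) => //.
  by rewrite ltr_pdivrMr// ltr_pMr// ltr1n.
by rewrite -EFinM mulVf// gt_eqF.
Qed.

Lemma patch_indic (E A : set X) : (\1_E : X -> R) \_ A = \1_(E `&` A).
Proof.
apply/funext => x; rewrite patchE !indicE in_setI.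
by case: (x \in A); rewrite ?andbT ?andbF.
Qed.

Lemma indic_LPhi_loc (x0 : X) (r : R) : 0 < r ->
  LPhi_loc d mu Phi (\1_(B x0 r) : X -> R).
Proof.
move=> r0 x s s0; rewrite patch_indic.
have mE : measurable (B x0 r `&` B x s) by apply: measurableI; exact: mball.
have Efin : (mu (B x0 r `&` B x s) < +oo)%E.
  apply: (@le_lt_trans _ _ (mu (B x s))).
    by apply: le_measure; rewrite ?inE//; exact: mball.
  by rewrite (volE hmu)// ltry.
split.
  move=> y t t0; apply: (@integrableS _ _ _ _ setT) => //; first exact: mball.
  apply/integrableP; split; first by apply/measurable_EFinP; exact: measurable_indic.
  under eq_integral do rewrite /= ger0_norm//.
  by rewrite integral_indic// setIT.
exists 1 => //; rewrite (integral_Phi_indic mE ler01).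
by rewrite lte_mul_pinfty// lee_fin starshaped_ge0.
Qed.

(** A small ball around [x] is removed so that the distance is positive, since the kernel takes the
    value 0 on the diagonal. On the rest the distance is below [2 * K1 * r]. *)
Lemma riesz_indic_ge (alpha r : R) x0 x : 0 < alpha < Q -> 0 < r -> B x0 r x ->
  (((2 * K1) `^ (- (Q - alpha)) / (2 * K3) * r `^ alpha)%:E <=
   riesz d mu Q alpha (\1_(B x0 r)) x)%E.
Proof.
move=> /andP[al0 alQ] r0 xB.
have mB0 := mball x0 r0.
have K2 : 0 < (2 * K3 * K3)^-1 by rewrite invr_gt0 !mulr_gt0.
(* Chosen so that K3 (e r)^Q is half of K3^-1 r^Q, the lower bound for the large ball; [A] keeps the
   other half. *)
pose e := (2 * K3 * K3)^-1 `^ Q^-1.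
have e0 : 0 < e by rewrite powR_gt0.
have er0 : 0 < e * r by exact: mulr_gt0.
have mBe := mball x er0.
pose A := B x0 r `\` B x (e * r).
have mA : measurable A by exact: measurableD.
have muA : ((r `^ Q / (2 * K3))%:E <= mu A)%E.
  have : (mu (B x0 r) <= mu A + mu (B x (e * r)))%E.
    rewrite -[leLHS]/(mu (B x0 r)).
    apply: (@le_trans _ _ (mu (A `|` B x (e * r)))).
      apply: le_measure; rewrite ?inE//; first exact: measurableU.
      by move=> y yB; have [?|?] := pselect (B x (e * r) y); [right|left].
    exact: measureU2.
  have [] := (hmu x0 r0, hmu x er0).
  move=> /andP[h1 _] /andP[_ h2] h3.
  have := le_trans h1 (le_trans h3 (leeD (lexx _) h2)).
  rewrite powRM ?(ltW e0) ?(ltW r0)// {1}/e powR_inv_powRK ?(ltW K2)//.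
  rewrite addeC -leeBlDl// -EFinB; apply: le_trans; rewrite lee_fin.
  have K3n : K3 != 0 by rewrite gt_eqF.
  have -> : K3 * ((2 * K3 * K3)^-1 * r `^ Q) = 2^-1 * K3^-1 * r `^ Q.
    rewrite !invfM; transitivity (2^-1 * K3^-1 * r `^ Q * (K3 / K3)); first by lra.
    by rewrite divff// mulr1.
  rewrite invfM; lra.
have K0 y : (0 <= riesz_kernel d Q alpha (\1_(B x0 r)) x y)%E.
  by rewrite lee_fin divr_ge0 ?powR_ge0.
have mK : measurable_fun setT (riesz_kernel d Q alpha (\1_(B x0 r)) x).
  by apply: (measurable_riesz_kernel Q alpha dq mball); exact: measurable_indic.
apply: (@le_trans _ _ (\int[mu]_(y in A) riesz_kernel d Q alpha (\1_(B x0 r)) x y)%E);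
  last exact: ge0_subset_integral.
have Kr0 : 0 < 2 * K1 * r by rewrite !mulr_gt0.
apply: (@le_trans _ _ (\int[mu]_(y in A) (cst ((2 * K1 * r) `^ (- (Q - alpha)))%:E) y)%E).
  rewrite integral_cst//.
  apply: (@le_trans _ _ (((2 * K1 * r) `^ (- (Q - alpha)))%:E *
      (r `^ Q / (2 * K3))%:E)%E); last first.
    by apply: lee_pmul => //; rewrite lee_fin ?powR_ge0 ?divr_ge0 ?powR_ge0 ?mulr_ge0 ?ltW.
  have K1p : 0 < 2 * K1 by exact: mulr_gt0.
  rewrite -EFinM lee_fin (@powRM _ (2 * K1)) ?(ltW K1p) ?(ltW r0)//.
  have rr : r `^ (- (Q - alpha)) * r `^ Q = r `^ alpha.
    rewrite -powRD; last by rewrite (gt_eqF r0) implybT.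
    by congr (_ `^ _); lra.
  rewrite -rr; lra.
apply: ge0_le_integral => //.
- by move=> y _; rewrite lee_fin powR_ge0.
- exact: measurable_funTS.
move=> y [yB yBe]; rewrite /riesz_kernel lee_fin indicE mem_set// mul1r powRN.
have dxy : 0 < d x y.
  by apply: lt_le_trans er0 _; rewrite leNgt; apply/negP.
rewrite lef_pV2 ?posrE ?powR_gt0//.
rewrite ge0_ler_powR ?nnegrE ?subr_ge0 ?(ltW alQ) ?(ltW dxy) ?(ltW Kr0)//.
apply: le_trans (qdist_triangle dq x y x0) _.
rewrite [2 * K1]mulrC -mulrA ler_pM2l// (qdistC dq).
by move: xB yB; rewrite /qball/=; lra.
Qed.

Section class_G.
Variable phi : R -> R.
Hypothesis phiG : class_G Q Phi phi.

Lemma class_G_dominated : exists2 C, 0 < C & dominated Q Phi phi C.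
Proof.
have [phi0 [C C0 HC] _] := phiG; exists C^-1; first by rewrite invr_gt0.
move=> t c t0 c0 /(_ t (lexx _)); have q0 := rinv_gt0 sP PhiE (powR_gt0 (- Q) t0).
rewrite ler_pdivlMr// => ct r /andP[r0 rt]; rewrite mulrC; apply: le_trans ct _.
by rewrite ler_pdivlMl// -lee_fin EFinM; apply: HC => //; exact: ltW.
Qed.

Lemma M_norm_indic_le : exists2 C, 0 < C & forall x0 r, 0 < r ->
  (M_norm d mu Phi phi (\1_(B x0 r)) <= (C / phi r)%:E)%E.
Proof.
have [phi0 [Cd Cd0 HCd] [Ci Ci0 HCi]] := phiG.
have c10 : 0 < 2 / Cd by rewrite divr_gt0.
have c20 : 0 < 2 * K3 * K3 * Ci by rewrite !mulr_gt0.
exists (2 / Cd + 2 * K3 * K3 * Ci); first by rewrite addr_gt0.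
move=> x0 r r0; apply: ge_ereal_sup => _ [[x s] /= s0 <-].
have p0 := phi0 _ r0; have ps0 := phi0 _ s0.
rewrite (young_inv_vol K31 hmu sP PhiE)// patch_indic.
have mE : measurable (B x0 r `&` B x s) by apply: measurableI; exact: mball.
have ri0 := rinv_vol_gt0 K31 hmu sP PhiE x s0.
have cp0 : 0 <= (phi s)^-1 * rinv (vol x s)^-1.
  by rewrite mulr_ge0 ?invr_ge0// ltW.
rewrite -EFinM.
(* Small balls: the indicator is measured against [B x s] itself, the inverse Young functions
   cancel, and almost decrease compares phi(s) with phi(r). *)
have [sr|rs] := leP s r.
  have vs0 := vol_gt0 K31 hmu x s0.
  apply: (@le_trans _ _ (((phi s)^-1 * rinv (vol x s)^-1)%:E *
      (2 / rinv (vol x s)^-1)%:E)%E).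
    apply: lee_wpmul2l => //; apply: Luxemburg_indic_le => //.
    rewrite -(volE hmu)//; apply: le_measure; rewrite ?inE//; exact: mball.
  rewrite -EFinM lee_fin.
  have -> : (phi s)^-1 * rinv (vol x s)^-1 * (2 / rinv (vol x s)^-1) = 2 / phi s.
    rewrite mulrACA [_ * (_ * _^-1)]mulrC; set q := rinv _ in ri0 *.
    transitivity (2 / phi s * (q / q)); first by lra.
    by rewrite divff ?mulr1// gt_eqF.
  apply: (@le_trans _ _ (2 / Cd / phi r)); last first.
    by rewrite ler_wpM2r ?invr_ge0 ?(ltW p0)// lerDl ltW.
  rewrite -[_ / phi r]mulrA -invfM ler_pM2l// lef_pV2 ?posrE ?mulr_gt0//.
  by rewrite -lee_fin EFinM; exact: HCd.
(* Large balls: the indicator is measured against [B x0 r], and the surviving quotient of inverse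
   Young functions is handled by the almost increase of phi(t) / Phi^-1(t^-Q). *)
have vr0 := vol_gt0 K31 hmu x0 r0.
have rr0 := rinv_vol_gt0 K31 hmu sP PhiE x0 r0.
apply: (@le_trans _ _ (((phi s)^-1 * rinv (vol x s)^-1)%:E *
      (2 / rinv (vol x0 r)^-1)%:E)%E).
  apply: lee_wpmul2l => //; apply: Luxemburg_indic_le => //.
  rewrite -(volE hmu)//; apply: le_measure; rewrite ?inE//; exact: mball.
rewrite -EFinM lee_fin.
have h1 := rinv_vol_le K31 hmu sP PhiE x s0.
have h2 := rinv_powR_le K31 hmu sP PhiE x0 r0.
have := HCi r s r0 (ltW rs).
have qr0 := rinv_gt0 sP PhiE (powR_gt0 (- Q) r0).
have qs0 := rinv_gt0 sP PhiE (powR_gt0 (- Q) s0).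
rewrite !(rinvE sP PhiE) ?powR_gt0// !inver !gt_eqF// -!EFinM lee_fin => h3.
set q1 := rinv (vol x s)^-1 in h1 ri0 *.
set q2 := rinv (vol x0 r)^-1 in h2 rr0 *.
set qr := rinv (r `^ (- Q)) in h2 h3 qr0 *.
set qs := rinv (s `^ (- Q)) in h1 h3 qs0 *.
apply: (@le_trans _ _ (2 * K3 * K3 * Ci / phi r)); last first.
  by rewrite ler_wpM2r ?invr_ge0 ?(ltW p0)// lerDr ltW.
rewrite ler_pdivlMr//.
have -> : (phi s)^-1 * q1 * (2 / q2) * phi r = 2 * q1 * phi r / (phi s * q2).
  by rewrite invfM; lra.
rewrite ler_pdivrMr ?mulr_gt0//.
move: h3; rewrite ler_pdivrMr// mulrA mulrAC ler_pdivlMr// => h3.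
have h4 : phi r * q1 <= phi r * (K3 * qs) by rewrite ler_pM2l.
have h5 : K3 * (phi r * qs) <= K3 * (Ci * phi s * qr) by rewrite ler_pM2l.
have h6 : K3 * Ci * phi s * qr <= K3 * Ci * phi s * (K3 * q2).
  by rewrite ler_pM2l// !mulr_gt0.
lra.
Qed.

Lemma riesz_bounded_necessary (alpha beta : R) : 0 < alpha < Q -> 0 < beta < 1 ->
  riesz_bounded d mu Q alpha Phi phi (fun t => Phi (t `^ beta^-1))
    (fun t => phi t `^ beta) ->
  exists2 C : R, 0 < C &
    forall t, 0 < t -> t `^ alpha * phi t <= C * phi t `^ beta.
Proof.
move=> aQ b01 [Cb Cb0 HCb]; have [b0 b1] := andP b01.
have [Cg Cg0 HCg] := M_norm_indic_le.
have [phi0 _ _] := phiG.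
pose c1 := (2 * K1) `^ (- (Q - alpha)) / (2 * K3).
have c10 : 0 < c1 by rewrite divr_gt0 ?powR_gt0 ?mulr_gt0.
exists (2 `^ beta * 2 / c1 * (Cb * Cg)).
  by apply: mulr_gt0; [rewrite divr_gt0// mulr_gt0// powR_gt0|exact: mulr_gt0].
move=> r r0; have p0 := phi0 _ r0.
pose x0 : X := point; pose f : X -> R := \1_(B x0 r).
set Psi := fun t => Phi (t `^ beta^-1) in HCb.
have Mf : M_space d mu Phi phi f.
  split; first exact: indic_LPhi_loc.
  by apply: le_lt_trans (HCg x0 r r0) _; rewrite ltry.
have [_ _ WMle] := HCb f Mf.
have := le_trans WMle (lee_wpmul2l (ltW Cb0 : (0 <= Cb%:E)%E) (HCg x0 r r0)).
rewrite -EFinM => WMle'.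
have v0 := vol_gt0 K31 hmu x0 r0.
have q0 := rinv_vol_gt0 K31 hmu sP PhiE x0 r0.
set q := rinv _ in q0.
have vi0 : 0 < (vol x0 r)^-1 by rewrite invr_gt0.
(* Half the lower bound of the potential, so that the strict level set at [t0] contains the whole
   ball. *)
pose t0 := c1 * r `^ alpha / 2.
have t00 : 0 < t0 by rewrite divr_gt0// mulr_gt0// powR_gt0.
have norm_ge : ((t0 / q `^ beta)%:E <= WLPhi_norm mu Psi (riesz d mu Q alpha f \_ (B x0 r)))%E.
  apply: le_ereal_inf_tmp => _ [l [l0 Hl] <-]; rewrite lee_fin.
  have tl0 : 0 < t0 / l by exact: divr_gt0.
  have : (Psi (t0 / l)%R * distr mu (riesz d mu Q alpha f \_ (B x0 r)) t0 <= 1)%E.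
    by apply: le_trans Hl; apply: ereal_sup_ubound; exists t0.
  have dv : ((vol x0 r)%:E <= distr mu (riesz d mu Q alpha f \_ (B x0 r)) t0)%E.
    rewrite -(volE hmu)// -(measurable_mu_extE mu (mball x0 r0)).
    apply: le_mu_ext => x xB /=; rewrite patchE mem_set//.
    apply: (@lt_le_trans _ _ (c1 * r `^ alpha)%:E).
      rewrite lte_fin /t0 ltr_pdivrMr// ltr_pMr ?ltr1n//.
      by rewrite mulr_gt0// powR_gt0.
    apply: le_trans (lee_abs _); exact: riesz_indic_ge.
  have Psi0 : (0 <= Psi (t0 / l)%R)%E.
    by rewrite /Psi PhiE ?powR_ge0// lee_fin starshaped_ge0// powR_ge0.
  move=> /(le_trans (lee_wpmul2l Psi0 dv)).
  rewrite muleC -lee_pdivlMl// mule1 /Psi PhiE ?powR_ge0// lee_fin.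
  move=> /(rinv_ge sP PhiE vi0 (powR_ge0 _ _)); rewrite -/q => H.
  rewrite ler_pdivrMr ?powR_gt0// mulrC -ler_pdivrMr//.
  rewrite -[leLHS](powR_inv_powRK b0 (ltW tl0)).
  by rewrite ge0_ler_powR ?nnegrE ?powR_ge0 ?(ltW b0) ?(ltW q0).
(* [q / 2] lies strictly below the infimum [q], which guarantees that [Phi] there is at most the
   inverse volume. *)
have inv_ge : (((q / 2) `^ beta)%:E <= young_inv Psi (mu (B x0 r))^-1)%E.
  have q20 : 0 <= q / 2 by rewrite divr_ge0// ltW.
  apply: young_inv_ge; last 1 first.
  - rewrite /Psi -powRrM mulfV ?gt_eqF// powRr1// PhiE//.
    rewrite (volE hmu)// inver gt_eqF// lee_fin.
    apply: (le_rinv sP PhiE) => //.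
    by rewrite -/q ltr_pdivrMr// ltr_pMr// ltr1n.
  - move=> u v u0 v0' uv; rewrite /Psi !PhiE ?powR_ge0// lee_fin.
    apply: starshaped_le => //; first exact: powR_ge0.
    by rewrite ge0_ler_powR// invr_ge0 ltW.
  - exact: powR_ge0.
have : (((phi r `^ beta)^-1 * (q / 2) `^ beta * (t0 / q `^ beta))%:E <=
    (Cb * (Cg / phi r))%:E)%E.
  apply: le_trans WMle'; apply: (@le_trans _ _ ((phi r `^ beta)^-1%:E *
      young_inv Psi (mu (B x0 r))^-1 *
      WLPhi_norm mu Psi (riesz d mu Q alpha f \_ (B x0 r)))%E); last first.
    by apply: ereal_sup_ubound; exists (x0, r).
  rewrite EFinM; apply: lee_pmul => //.
  - by rewrite lee_fin mulr_ge0 ?invr_ge0 ?powR_ge0.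
  - by rewrite lee_fin divr_ge0 ?powR_ge0// ltW.
  - rewrite EFinM; apply: lee_wpmul2l => //.
    by rewrite lee_fin invr_ge0 powR_ge0.
rewrite lee_fin (@powRM _ q) ?invr_ge0 ?(ltW q0)//.
have e0 : 0 < phi r `^ beta by rewrite powR_gt0.
have qb0 : 0 < q `^ beta by rewrite powR_gt0.
have -> : 2^-1 `^ beta = (2 `^ beta)^-1 :> R.
  by rewrite -powR_inv1// powRAC powR_inv1// powR_ge0.
have b20 : 0 < 2 `^ beta :> R by rewrite powR_gt0.
rewrite /t0; move: (phi r `^ beta) (q `^ beta) (2 `^ beta) e0 qb0 b20.
move=> e qb tb e0 qb0 tb0.
have -> : e^-1 * (qb / tb) * (c1 * r `^ alpha / 2 / qb) =
    c1 * r `^ alpha / (e * tb * 2) :> R.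
  rewrite !invfM; transitivity (c1 * r `^ alpha * (e^-1 * tb^-1 * 2^-1) * (qb / qb)).
    lra.
  by rewrite divff ?mulr1// gt_eqF.
rewrite ler_pdivrMr ?mulr_gt0//.
have -> : Cb * (Cg / phi r) * (e * tb * 2) = Cb * Cg * (e * tb * 2) / phi r by lra.
rewrite ler_pdivlMr// => H.
have -> : tb * 2 / c1 * (Cb * Cg) * e = Cb * Cg * (e * tb * 2) / c1 by lra.
by rewrite ler_pdivlMr//; lra.
Qed.

End class_G.
End necessity.

(** * The supremal condition of part 1, and the three statements *)

Lemma ess_inf_dominated (R : realType) (Q : R) (Phi : R -> \bar R) (P : R -> R) (phi : R -> R)
    (C : R) :
  starshaped P -> represents P Phi ->
  (forall r, 0 < r ->
    (ereal_sup [set young_inv Phi (t `^ (- Q))%:E *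
        ess_inf_above t
          (fun s => (phi s)%:E / young_inv Phi (s `^ (- Q))%:E)
      | t in [set t : R | (r < t)%R]] <= (C * phi r)%:E)%E) ->
  dominated Q Phi phi C.
Proof.
move=> sP PhiE H t c t0 c0 cs r /andP[r0 rt].
have q0 s : 0 < s -> 0 < rinv Phi (s `^ (- Q)).
  by move=> s0; apply: (rinv_gt0 sP PhiE); rewrite powR_gt0.
rewrite -lee_fin; apply: le_trans (H r r0).
apply: (@le_trans _ _ (young_inv Phi (t `^ (- Q))%:E * ess_inf_above t
  (fun s => (phi s)%:E / young_inv Phi (s `^ (- Q))%:E))%E); last first.
  by apply: ereal_sup_ubound; exists t.
rewrite (rinvE sP PhiE) ?powR_gt0// EFinM; apply: lee_wpmul2l.
  by rewrite lee_fin ltW// q0.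
apply/ess_infP; exists `]-oo, t]%classic; split => //.
- rewrite /= /mrestr (_ : _ `&` _ = set0) ?measure0//.
  apply/seteqP; split => s //= []; rewrite !in_itv/= andbT => st /lt_le_trans/(_ st).
  by rewrite ltxx.
- move=> s /= Hs; rewrite in_itv/= leNgt; apply/negP => ts; apply: Hs.
  have s0 := lt_trans t0 ts.
  rewrite (rinvE sP PhiE) ?powR_gt0// inver gt_eqF ?q0// -EFinM lee_fin.
  by apply: cs; exact: ltW.
Qed.

Theorem theorem6p2 (R : realType) (disp : measure_display)
    (X : topMeasurableType disp) (d : X -> X -> R)
    (mu : {measure set X -> \bar R}) (Q alpha beta : R)
    (Phi : R -> \bar R) (phi : R -> R)
    (hX : homogeneous_type d mu)
    (muX : mu setT = +oo%E)
    (hdense : Cc_dense_L1 mu)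
    (hQ : 0 < Q)
    (hom : Q_homogeneous d mu Q)
    (halpha : 0 < alpha < Q)
    (hPhi : class_Y Phi)
    (hbeta : 0 < beta < 1)
    (phi_gt0 : forall r : R, 0 < r -> 0 < phi r)
    (mphi : measurable_fun (`]0, +oo[ : set R) phi) :
  let eta : R -> R := fun t => phi t `^ beta in
  let Psi : R -> \bar R := fun t => Phi (t `^ beta^-1) in
  let bounded := riesz_bounded d mu Q alpha Phi phi Psi eta in
  let star := exists2 C : R, 0 < C &
    forall t, 0 < t -> t `^ alpha * phi t <= C * phi t `^ beta in
  let tail (t : R) : \bar R :=
    (\int[lebesgue_measure]_(r in `]t, +oo[) (r `^ alpha * phi r / r)%:E)%E in
  [/\
    (exists2 C : R, 0 < C & forall r, 0 < r ->
      (ereal_sup [set young_inv Phi (t `^ (- Q))%:E *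
          ess_inf_above t
            (fun s => (phi s)%:E / young_inv Phi (s `^ (- Q))%:E)
        | t in [set t : R | (r < t)%R]] <= (C * phi r)%:E)%E) ->
    (exists2 C : R, 0 < C & forall t, 0 < t ->
      ((t `^ alpha * phi t)%:E + tail t <= (C * phi t `^ beta)%:E)%E) ->
    bounded,
    class_G Q Phi phi -> bounded -> star
  & class_G Q Phi phi ->
    (exists2 C : R, 0 < C & forall t, 0 < t ->
      (tail t <= (C * (t `^ alpha * phi t))%:E)%E) ->
    (bounded <-> star)].
Proof.
move=> eta Psi bounded star tail.
have [[K1 K11 dq] _ mball _] := hX.
have [K3 K31 hmu] := hom.
have [P sP PhiE] := class_Y_starshaped hPhi.
have sufficient C Cs : 0 < C -> dominated Q Phi phi C -> 0 < Cs ->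
    (forall t, 0 < t ->
      ((t `^ alpha * phi t)%:E + tail t <= (Cs * phi t `^ beta)%:E)%E) -> bounded.
  by move=> C0 HC Cs0 HCs; exact: (riesz_bounded_sufficient dq K11 K31 hQ mball hmu
    sP PhiE phi_gt0 halpha hbeta mphi C0 HC Cs0 HCs).
have necessary : class_G Q Phi phi -> bounded -> star.
  by move=> phiG; exact: (riesz_bounded_necessary dq K11 K31 hQ mball hmu
    sP PhiE phiG halpha hbeta).
split => //.
- move=> [C C0 HC] [Cs Cs0 HCs].
  exact: (sufficient C Cs C0 (ess_inf_dominated sP PhiE HC) Cs0 HCs).
- move=> phiG [Ct Ct0 HCt]; split; first exact: necessary.
  move=> [C C0 HC].
  have [D D0 HD] := class_G_dominated sP PhiE phiG.
  (* The regularity condition absorbs the tail into t^alpha phi(t), so the pointwise condition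
     becomes the full integral condition at the cost of [1 + Ct]. *)
  apply: (sufficient D ((1 + Ct) * C) D0 HD).
    by rewrite mulr_gt0// addr_gt0.
  move=> t t0; apply: le_trans (leeD (lexx _) (HCt t t0)) _.
  rewrite -EFinD lee_fin -mulrA.
  have Ct10 : 0 < 1 + Ct by rewrite addr_gt0.
  apply: (@le_trans _ _ ((1 + Ct) * (t `^ alpha * phi t))); first lra.
  by rewrite ler_pM2l// HC.
Qed.
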